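(* Let $\mathcal{A}_N$ be the extended quantum Euclidean algebra and $\mathcal{A}_N\rtimes U_q^+so(N)$ its cross product with the positive Borel part of $U_qso(N)$ (both defined in the context). Put $$\bar\lambda_0=\bar\gamma_0\,\Lambda^{-1} (x^0)^{-1}\ (N\text{ odd}),\qquad \bar\lambda_{\pm1}=\bar\gamma_{\pm1}\,\Lambda^{-1} (x^{\pm1})^{-1}K^{\pm1}\ (N\text{ even}),\qquad \bar\lambda_a=\bar\gamma_a\,\Lambda^{-1}\, r_{|a|}^{-1}r_{|a|-1}^{-1}x^{-a}\ \text{ otherwise},$$ where the $\bar\gamma_a\in\mathbb{C}$ are any constants satisfying $$\bar\gamma_0=q^{1/2}h^{-1}\ (N\text{ odd}),\qquad \bar\gamma_1\bar\gamma_{-1}=\begin{cases}-q\,h^{-2}& N\text{ odd}\\ k^{-2}& N\text{ even}\end{cases},\qquad \bar\gamma_a\bar\gamma_{-a}=-q\,k^{-2}\omega_a\omega_{a-1}\ \text{ for } a>1 .$$ Then there is an algebra homomorphism $\varphi^+:\mathcal{A}_N\rtimes U_q^+so(N)\to\mathcal{A}_N$ given on generators by $$\varphi^+(a)=a\quad(a\in\mathcal{A}_N),\qquad \varphi^+(\mathcal{L}^{+}{}^i_j)=g^{ih}\,\Lambda[\bar\lambda_h,x^k]\,g_{kj}.$$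
   Context: **Conventions.** $N\ge 3$; $q\in\mathbb{C}\setminus\{0\}$ is not a root of unity and a square root $q^{1/2}$ is fixed; $k=q-q^{-1}$, $h=q^{1/2}-q^{-1/2}$. $n=(N-1)/2$ for $N$ odd, $n=N/2$ for $N$ even. Indices run over $-n,\dots,n$, with $0$ omitted when $N$ is even; repeated upper/lower indices are summed. $\rho_{\mp i}=\pm(i-\tfrac12)$ for $i>0$ and $\rho_0=0$ ($N$ odd); $\rho_{\mp i}=\pm(i-1)$ for $i>0$ ($N$ even). $\omega_i=q^{\rho_i}+q^{-\rho_i}$. $g_{ij}=g^{ij}=q^{-\rho_i}\delta_{i,-j}$. **Braid matrix.** With $E_{ij}$ the $N\times N$ matrix unit (1 in row $i$, column $j$) and $(A\otimes B)^{ij}_{kl}=A_{ik}B_{jl}$, $$\hat R=q\sum_{i\ne0}E_{ii}\otimes E_{ii}+\sum_{i\neq\pm j\text{ or }i=j=0}E_{ij}\otimes E_{ji}+q^{-1}\sum_{i\neq0}E_{i,-i}\otimes E_{-i,i}+k\Big(\sum_{i<j}E_{ii}\otimes E_{jj}-\sum_{i<j}q^{-\rho_i+\rho_j}E_{i,-j}\otimes E_{-i,j}\Big).$$ **The algebra $\mathcal{A}_N$.** Unital associative algebra generated by $x^i$, $r_j^{\pm1}$ ($0\le j\le n$ for $N$ odd, $1\le j\le n$ for $N$ even), $\Lambda^{\pm1}$ and, for $N$ even only, $K^{\pm1}$, with relations: $x^ix^j=qx^jx^i$ for $i<j$, $i\ne-j$; $[x^i,x^{-i}]=k\,\omega_{i-1}^{-1}r_{i-1}^2$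 for $i>1$; $[x^1,x^{-1}]=0$ ($N$ even), $=h\,r_0^2$ ($N$ odd); $r_i^2=\sum_{k,l=-i}^{i}g_{kl}x^kx^l$, and $r_0=x^0$ for $N$ odd; $x^jr_i=r_ix^j$ for $|j|\le i$, $x^jr_i=q\,r_ix^j$ for $j<-i$, $x^jr_i=q^{-1}r_ix^j$ for $j>i$; $r_ir_j=r_jr_i$; $x^i\Lambda=q\Lambda x^i$, $r_i\Lambda=q\Lambda r_i$; and for $N$ even $Kx^{\pm1}=q^{\pm1}x^{\pm1}K$, $Kx^{\pm i}=x^{\pm i}K$ ($i>1$), $Kr_i=r_iK$, $K\Lambda=\Lambda K$. (For $N$ even $x^{\pm1}$ is invertible, since $r_1^2=2x^{1}x^{-1}$.) **$U_q^+so(N)$** is the algebra generated by $\mathcal{L}^+{}^i_j$ with relations $\mathcal{L}^+{}^i_j=0$ for $i>j$; $\mathcal{L}^+{}^{-n}_{-n}\cdots\mathcal{L}^+{}^{n}_{n}=1$; $\mathcal{L}^+{}^i_j\mathcal{L}^+{}^h_kg^{kj}=g^{hi}$, $\mathcal{L}^+{}^j_i\mathcal{L}^+{}^k_hg_{kj}=g_{hi}$; $\hat R^{ab}_{cd}\mathcal{L}^+{}^d_f\mathcal{L}^+{}^c_e=\mathcal{L}^+{}^b_c\mathcal{L}^+{}^a_d\hat R^{dc}_{ef}$. **Cross product.** $\mathcal{A}_N\rtimes U_q^+so(N)$ is the algebra generated by $\mathcal{A}_N$ and $U_q^+so(N)$ with the cross relations $x^i\mathcal{L}^+{}^a_b=\mathcal{L}^+{}^a_c\,x^j\,\hat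 R^{ci}_{jb}$ and $\Lambda\mathcal{L}^+{}^a_b=\mathcal{L}^+{}^a_b\Lambda$. *)

(* Defs.v *)
From HB Require Import structures.
From mathcomp Require Import all_boot all_order all_algebra.
From mathcomp Require Import generic_quotient ring_quotient zify.
From mathcomp Require Import boolp classical_sets reals.
From mathcomp Require Import complex.
From mathcomp.multinomials Require Import monalg.

Set Implicit Arguments.
Unset Strict Implicit.
Unset Printing Implicit Defensive.

Import Order.TTheory GRing.Theory Num.Theory.

Local Open Scope quotient_scope.
Local Open Scope ring_scope.

(* The free unital associative C-algebra on X is the monoid algebra of the    *)
(* free monoid on X.                                                          *)
Notation free_alg C X := {malg C[{fmonom X}]}.

Definition fgen (C : fieldType) (X : choiceType) (x : X) : free_alg C X :=
  << fmu x >>.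

Section Freemap.
Variables (C : fieldType) (X Y : choiceType) (f : X -> Y).

Definition wordmap (m : {fmonom X}) : free_alg C Y :=
  \prod_(x <- m) fgen C (f x).

Definition freemap : free_alg C X -> free_alg C Y :=
  mmap (@malgC {fmonom Y} C) wordmap.

Lemma wordmap_mmorphism : mmorphism wordmap.
Proof.
split=> [m1 m2|]; first by rewrite /wordmap fmM big_cat.
by rewrite /wordmap fm1 big_nil.
Qed.
HB.instance Definition _ :=
  isMultiplicative.Build {fmonom X} (free_alg C Y) wordmap wordmap_mmorphism.

Lemma freemap_is_zmod_morphism : zmod_morphism freemap.
Proof. exact: mmapB. Qed.

Lemma malgC_comm (c : C) (u : free_alg C Y) : GRing.comm c%:MP u.
Proof.
rewrite /GRing.comm mul_malgC; apply/malgP => m.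
rewrite mcoeffZ malgM_def fgmulgU raddf_sum /= {1}[u]monalgE !raddf_sum /=.
rewrite mulr_sumr; apply: eq_bigr => i _.
by rewrite !mcoeffU mulm1 mulrnAr mulrC.
Qed.

Lemma freemap_is_monoid_morphism : monoid_morphism freemap.
Proof.
have [] := @commr_mmap_is_multiplicative _ _ _
  (@malgC {fmonom Y} C) wordmap (fun u m m' => malgC_comm _ _).
by [].
Qed.

HB.instance Definition _ :=
  GRing.isZmodMorphism.Build _ _ freemap freemap_is_zmod_morphism.
HB.instance Definition _ :=
  GRing.isMonoidMorphism.Build _ _ freemap freemap_is_monoid_morphism.

Lemma freemapZ : scalable freemap.
Proof. by move=> c u; rewrite /freemap mmapZ mul_malgC. Qed.

Lemma freemap_gen (x : X) : freemap (fgen C x) = fgen C (f x).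
Proof.
by rewrite /freemap /fgen mmapU mul_malgC scale1r /wordmap fmU big_seq1.
Qed.

End Freemap.

Section Presented.
Variables (C : fieldType) (X : choiceType).
Variable rel : free_alg C X -> free_alg C X -> Prop.

(* The two-sided ideal generated by the u - v such that rel u v.              *)
Inductive in_relators : free_alg C X -> Prop :=
| relators_rel u v of rel u v : in_relators (u - v)
| relators_0 : in_relators 0
| relators_B u v of in_relators u & in_relators v : in_relators (u - v)
| relators_M a u b of in_relators u : in_relators (a * u * b).

Definition relators : {pred free_alg C X} := fun u => `[< in_relators u >].

Lemma relators_zmod_closed : zmod_closed relators.
Proof.
split; first by apply/asboolP; exact: relators_0.
move=> u v /asboolP Iu /asboolP Iv; apply/asboolP; exact: relators_B.
Qed.
HB.instance Definition _ :=
  GRing.isZmodClosed.Build _ relators relators_zmod_closed.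

Definition presented := Quotient.quot relators.
HB.instance Definition _ := GRing.Zmodule.on presented.
HB.instance Definition _ := Quotient.on presented.

Lemma piP (u v : free_alg C X) :
  reflect (in_relators (u - v)) (\pi_presented u == \pi_presented v).
Proof. by rewrite -Quotient.idealrBE; apply: asboolP. Qed.

Lemma pi_rel u v : rel u v -> \pi_presented u = \pi_presented v.
Proof. by move=> ruv; apply/eqP/piP/relators_rel. Qed.

Lemma repr_relators u : in_relators (repr (\pi_presented u) - u).
Proof. by apply/piP; rewrite reprK. Qed.

Definition presented_one : presented := lift_cst presented 1.
Definition presented_mul : presented -> presented -> presented :=
  lift_op2 presented *%R.
Definition presented_scale (c : C) : presented -> presented :=
  lift_op1 presented ( *:%R c).

Lemma piB u v : \pi_presented (u - v) = \pi u - \pi v.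
Proof. exact: (raddfB (\pi_presented)). Qed.
Lemma piD u v : \pi_presented (u + v) = \pi u + \pi v.
Proof. exact: (raddfD (\pi_presented)). Qed.

Lemma pi1 : \pi_presented 1 = presented_one.
Proof. by rewrite /presented_one; unlock. Qed.

Lemma piM u v : \pi_presented (u * v) = presented_mul (\pi u) (\pi v).
Proof.
rewrite /presented_mul; unlock.
apply/esym/eqP/piP; set u' := repr _; set v' := repr _.
have -> : u' * v' - u * v = 1 * (u' - u) * v' - u * (v - v') * 1.
  by rewrite mul1r mulr1 mulrBl mulrBr opprB addrA subrK.
apply: relators_B; first exact/relators_M/repr_relators.
apply: relators_M; rewrite -opprB -[- _]sub0r.
exact: relators_B relators_0 (repr_relators _).
Qed.

Lemma piZ c u : \pi_presented (c *: u) = presented_scale c (\pi u).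
Proof.
rewrite /presented_scale; unlock.
apply/esym/eqP/piP; rewrite -scalerBr -mul_malgC -[_ * _]mulr1.
exact/relators_M/repr_relators.
Qed.

Lemma presented_mulA : associative presented_mul.
Proof.
move=> a b c; rewrite -[a]reprK -[b]reprK -[c]reprK.
by rewrite -!piM mulrA.
Qed.
Lemma presented_mul1l : left_id presented_one presented_mul.
Proof. by move=> a; rewrite -[a]reprK -pi1 -piM mul1r. Qed.
Lemma presented_mul1r : right_id presented_one presented_mul.
Proof. by move=> a; rewrite -[a]reprK -pi1 -piM mulr1. Qed.
Lemma presented_mulDl : left_distributive presented_mul +%R.
Proof.
move=> a b c; rewrite -[a]reprK -[b]reprK -[c]reprK.
by rewrite -piD -!piM -piD mulrDl.
Qed.
Lemma presented_mulDr : right_distributive presented_mul +%R.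
Proof.
move=> a b c; rewrite -[a]reprK -[b]reprK -[c]reprK.
by rewrite -piD -!piM -piD mulrDr.
Qed.
HB.instance Definition _ := GRing.Zmodule_isPzRing.Build presented
  presented_mulA presented_mul1l presented_mul1r
  presented_mulDl presented_mulDr.

Lemma presented_scaleA c d a :
  presented_scale c (presented_scale d a) = presented_scale (c * d) a.
Proof. by rewrite -[a]reprK -!piZ scalerA. Qed.
Lemma presented_scale1 : left_id 1 presented_scale.
Proof. by move=> a; rewrite -[a]reprK -piZ scale1r. Qed.
Lemma presented_scaleDr : right_distributive presented_scale +%R.
Proof.
by move=> c a b; rewrite -[a]reprK -[b]reprK -piD -!piZ scalerDr piD.
Qed.
Lemma presented_scaleDl a : {morph presented_scale^~ a : c d / c + d}.
Proof. by move=> c d; rewrite -[a]reprK -!piZ scalerDl piD. Qed.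
HB.instance Definition _ := GRing.Zmodule_isLmodule.Build C presented
  presented_scaleA presented_scale1 presented_scaleDr presented_scaleDl.

(* presented is a C-algebra, but it may be trivial, so that it only carries   *)
(* the structures pzRingType and lmodType C, related by the next two lemmas.  *)
Lemma presented_scaleAl (c : C) (a b : presented) :
  c *: (a * b) = (c *: a) * b.
Proof.
rewrite -[a]reprK -[b]reprK -[LHS]/(presented_scale _ (presented_mul _ _)).
rewrite -[RHS]/(presented_mul (presented_scale _ _) _).
by rewrite -!(piM, piZ) scalerAl.
Qed.

Lemma presented_scaleAr (c : C) (a b : presented) :
  c *: (a * b) = a * (c *: b).
Proof.
rewrite -[a]reprK -[b]reprK -[LHS]/(presented_scale _ (presented_mul _ _)).
rewrite -[RHS]/(presented_mul _ (presented_scale _ _)).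
by rewrite -!(piM, piZ) -!mul_malgC !mulrA malgC_comm.
Qed.

End Presented.

(* The two-sided inverse of a, when there is one; 0 otherwise.                *)
Definition ainv (A : pzRingType) (a : A) : A :=
  xget 0 [set b | a * b = 1 /\ b * a = 1]%classic.

Lemma ainv_eq (A : pzRingType) (a b : A) : a * b = 1 -> b * a = 1 -> ainv a = b.
Proof.
move=> ab ba; rewrite /ainv; case: xgetP => [c _ [_ ca]|/(_ b)]; last by case.
by rewrite -[c]mulr1 -ab mulrA ca mul1r.
Qed.

(* N = 2n or N = 2n + 1 with n = N./2. The index set {-n, ..., n}, without 0  *)
(* when N is even, is identified with 'I_N in increasing order; idx gives the *)
(* actual value of an index, and rev_ord is the sign change.                  *)
Section Indices.
Variable N : nat.

Definition idx (i : 'I_N) : int :=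
  i%:Z - N./2%:Z + (~~ odd N && (N./2 <= i)%N)%:Z.

Lemma idx_rev i : idx (rev_ord i) = - idx i.
Proof. by rewrite /idx /=; case: i => i /=; lia. Qed.

Lemma idx_lt i j : (idx i < idx j) = (i < j)%N.
Proof. by rewrite /idx; lia. Qed.

Lemma idxP (z : int) :
  (exists i, idx i = z) <-> ((`|z| <= N./2)%N /\ (odd N || (z != 0))).
Proof.
split=> [[i <-]|[zn z0]]; first by rewrite /idx; case: i => i /=; lia.
pose m := (`|(z + N./2%:Z - (~~ odd N && (0 < z))%:Z)%R|)%N.
have mN : (m < N)%N by rewrite /m; lia.
by exists (Ordinal mN); rewrite /idx /= /m; lia.
Qed.

(* The range of the index of r_j.                                             *)
Definition rvalid (j : nat) : bool := (~~ odd N <= j <= N./2)%N.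

(* Twice rho_i.                                                               *)
Definition rho2 (i : int) : int :=
  - sgz i * ((2 * `|i|)%:Z - (if odd N then 1 else 2)).

End Indices.

Section Algebras.
(* qh is the chosen square root of q.                                         *)
Variables (C : fieldType) (q qh : C) (N : nat).

Definition k_ : C := q - q^-1.
Definition h_ : C := qh - qh^-1.
Definition qrho (i : int) : C := qh ^ rho2 N i.
Definition omega (i : int) : C := qrho i + (qrho i)^-1.

(* Both g_{ij} and g^{ij}.                                                    *)
Definition metric (i j : 'I_N) : C :=
  if i == rev_ord j then (qrho (idx i))^-1 else 0.

Definition tensor (A B : 'M[C]_N) (i j k l : 'I_N) : C := A i k * B j l.

(* Rhat a b c d is the entry with upper indices a b and lower indices c d.    *)
Definition Rhat (a b c d : 'I_N) : C :=
  let E := @delta_mx C N N in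
  q * (\sum_(i | idx i != 0) tensor (E i i) (E i i) a b c d)
  + \sum_i \sum_(j | (i != j) && (i != rev_ord j) || (idx i == 0) && (idx j == 0))
      tensor (E i j) (E j i) a b c d
  + q^-1 * (\sum_(i | idx i != 0)
      tensor (E i (rev_ord i)) (E (rev_ord i) i) a b c d)
  + k_ * (\sum_i \sum_(j | idx i < idx j) tensor (E i i) (E j j) a b c d
      - \sum_i \sum_(j | idx i < idx j) (qrho (idx i))^-1 * qrho (idx j)
          * tensor (E i (rev_ord j)) (E (rev_ord i) j) a b c d).

(* Generators of A_N; the suffix V marks a formal inverse.                    *)
Inductive genA : Type :=
| gx of 'I_N
| gr of {j : nat | rvalid N j}
| grV of {j : nat | rvalid N j}
| gL
| gLV
| gK of ~~ odd N
| gKV of ~~ odd N.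
HB.instance Definition _ := gen_eqMixin genA.
HB.instance Definition _ := gen_choiceMixin genA.

(* The generators as elements of the free algebra. Those that do not exist    *)
(* (r_j for j out of range, K for N odd) are given the dummy value 0, and are *)
(* never used.                                                                *)
Definition fx (i : 'I_N) : free_alg C genA := fgen C (gx i).
Definition fr (j : nat) : free_alg C genA :=
  if insub j is Some t then fgen C (gr t) else 0.
Definition frV (j : nat) : free_alg C genA :=
  if insub j is Some t then fgen C (grV t) else 0.
Definition fL : free_alg C genA := fgen C gL.
Definition fLV : free_alg C genA := fgen C gLV.
Definition fK : free_alg C genA :=
  if @idP (~~ odd N) is ReflectT e then fgen C (gK e) else 0.
Definition fKV : free_alg C genA :=
  if @idP (~~ odd N) is ReflectT e then fgen C (gKV e) else 0.

Inductive relA : free_alg C genA -> free_alg C genA -> Prop :=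
| A_xx i j of idx i < idx j & i != rev_ord j :
    relA (fx i * fx j) (q *: (fx j * fx i))
| A_xcomm i of 1 < idx i :
    relA (fx i * fx (rev_ord i) - fx (rev_ord i) * fx i)
         (k_ * (omega (idx i - 1))^-1 *: fr (`|idx i| - 1) ^+ 2)
| A_x1comm i of idx i = 1 :
    relA (fx i * fx (rev_ord i) - fx (rev_ord i) * fx i)
         (if odd N then h_ *: fr 0 ^+ 2 else 0)
| A_r2 j of rvalid N j :
    relA (fr j ^+ 2)
         (\sum_(k | (`|idx k| <= j)%N) \sum_(l | (`|idx l| <= j)%N)
            metric k l *: (fx k * fx l))
| A_r0 i of odd N & idx i = 0 :
    relA (fr 0) (fx i)
| A_xr i j of rvalid N j & `|idx i| <= j%:Z :
    relA (fx i * fr j) (fr j * fx i)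
| A_xr_lt i j of rvalid N j & idx i < - j%:Z :
    relA (fx i * fr j) (q *: (fr j * fx i))
| A_xr_gt i j of rvalid N j & j%:Z < idx i :
    relA (fx i * fr j) (q^-1 *: (fr j * fx i))
| A_rr i j of rvalid N i & rvalid N j :
    relA (fr i * fr j) (fr j * fr i)
| A_rrV j of rvalid N j : relA (fr j * frV j) 1
| A_rVr j of rvalid N j : relA (frV j * fr j) 1
| A_LLV : relA (fL * fLV) 1
| A_LVL : relA (fLV * fL) 1
| A_xL i : relA (fx i * fL) (q *: (fL * fx i))
| A_rL j of rvalid N j : relA (fr j * fL) (q *: (fL * fr j))
| A_KKV of ~~ odd N : relA (fK * fKV) 1
| A_KVK of ~~ odd N : relA (fKV * fK) 1
| A_Kx1 i of ~~ odd N & idx i = 1 : relA (fK * fx i) (q *: (fx i * fK))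
| A_KxN1 i of ~~ odd N & idx i = - 1 : relA (fK * fx i) (q^-1 *: (fx i * fK))
| A_Kx i of ~~ odd N & 1 < `|idx i| : relA (fK * fx i) (fx i * fK)
| A_Kr j of ~~ odd N & rvalid N j : relA (fK * fr j) (fr j * fK)
| A_KL of ~~ odd N : relA (fK * fL) (fL * fK).

Definition qeuclid := presented relA.
HB.instance Definition _ := GRing.PzRing.on qeuclid.
HB.instance Definition _ := GRing.Lmodule.on qeuclid.
HB.instance Definition _ := Quotient.on qeuclid.

Definition x_ (i : 'I_N) : qeuclid := \pi_qeuclid (fx i).
Definition rinv_ (j : nat) : qeuclid := \pi_qeuclid (frV j).
Definition Lambda : qeuclid := \pi_qeuclid fL.
Definition LambdaV : qeuclid := \pi_qeuclid fLV.
Definition K_ : qeuclid := \pi_qeuclid fK.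
Definition KV_ : qeuclid := \pi_qeuclid fKV.

(* fl i j stands for the generator with upper index i and lower index j.      *)
Definition genU : Type := 'I_N * 'I_N.
HB.instance Definition _ := Choice.on genU.
Definition fl (i j : 'I_N) : free_alg C genU := fgen C ((i, j) : genU).

Inductive relU : free_alg C genU -> free_alg C genU -> Prop :=
| U_tri i j of idx j < idx i : relU (fl i j) 0
| U_det : relU (\prod_(i < N) fl i i) 1
| U_metric_up i h :
    relU (\sum_j \sum_k metric k j *: (fl i j * fl h k)) (metric h i *: 1)
| U_metric_lo i h :
    relU (\sum_j \sum_k metric k j *: (fl j i * fl k h)) (metric h i *: 1)
| U_RLL a b e f :
    relU (\sum_c \sum_d Rhat a b c d *: (fl d f * fl c e))
         (\sum_c \sum_d Rhat d c e f *: (fl b c * fl a d)).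

Definition genX : Type := (genA + genU)%type.
HB.instance Definition _ := Choice.on genX.
Definition inA : free_alg C genA -> free_alg C genX :=
  freemap (inl : genA -> genX).
HB.instance Definition _ := GRing.RMorphism.on inA.
Definition inU : free_alg C genU -> free_alg C genX :=
  freemap (inr : genU -> genX).
HB.instance Definition _ := GRing.RMorphism.on inU.

Inductive relX : free_alg C genX -> free_alg C genX -> Prop :=
| X_A u v of relA u v : relX (inA u) (inA v)
| X_U u v of relU u v : relX (inU u) (inU v)
| X_xl i a b :
    relX (inA (fx i) * inU (fl a b))
         (\sum_c \sum_j Rhat c i j b *: (inU (fl a c) * inA (fx j)))
| X_Ll a b :
    relX (inA fL * inU (fl a b)) (inU (fl a b) * inA fL).

Definition crossprod := presented relX.
HB.instance Definition _ := GRing.PzRing.on crossprod.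
HB.instance Definition _ := GRing.Lmodule.on crossprod.
HB.instance Definition _ := Quotient.on crossprod.

Definition Lplus (i j : 'I_N) : crossprod := \pi_crossprod (inU (fl i j)).

Definition embA (a : qeuclid) : crossprod := \pi_crossprod (inA (repr a)).

Lemma embA_pi (u : free_alg C genA) :
  embA (\pi_qeuclid u) = \pi_crossprod (inA u).
Proof.
apply/eqP/piP; rewrite -rmorphB.
have := repr_relators relA u; elim=> [{}u v r|||a {}u b _ IH].
- by rewrite rmorphB; apply/relators_rel/X_A.
- by rewrite rmorph0; apply: relators_0.
- by move=> {}u v _ IHu _ IHv; rewrite rmorphB; apply: relators_B.
- by rewrite !rmorphM; apply: relators_M.
Qed.

(* ainv is meaningful here: for N odd, x^0 = r_0 is invertible; for N even,   *)
(* so are x^1 and x^{-1}, since they commute with each other and with r_1,    *)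
(* and r_1^2 = 2 x^1 x^{-1}.                                                  *)
Definition lambda_bar (gam : 'I_N -> C) (a : 'I_N) : qeuclid :=
  if odd N && (idx a == 0) then gam a *: (LambdaV * ainv (x_ a))
  else if ~~ odd N && (idx a == 1) then
    gam a *: (LambdaV * ainv (x_ a) * K_)
  else if ~~ odd N && (idx a == - 1) then
    gam a *: (LambdaV * ainv (x_ a) * KV_)
  else gam a *: (LambdaV * rinv_ `|idx a|%N * rinv_ (`|idx a| - 1)%N
                 * x_ (rev_ord a)).

End Algebras.

(* Main.v *)
(* Put E^k_h = [lambda_h, x^k].  It vanishes unless k <= h (with 1 and -1
   incomparable for N even), it is a multiple of lambda_h x^k for k < h, and the
   partial sums of q^{-rho_d} x^d x^{-d} are the r_i^2 up to a factor; so the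
   cross relation x E = R^ E x reduces to a case check.  The relations between
   the x^k and the lambda_h are self-dual under exchanging x^k with lambda_{-k}
   and q with 1/q, and under reversing products and exchanging q with 1/q.  Hence
   one computation yields the cross relation, its inverse and
   lambda E = R^ E lambda; the RLL and the metric relations follow from these. *)
Require Import Defs.
From HB Require Import structures.
From mathcomp Require Import all_boot all_order all_algebra.
From mathcomp Require Import generic_quotient ring_quotient zify ring.
From mathcomp Require Import reals complex.
From mathcomp Require boolp.
From mathcomp.multinomials Require Import monalg.

Set Implicit Arguments.
Unset Strict Implicit.
Unset Printing Implicit Defensive.

Import Order.TTheory GRing.Theory Num.Theory.

Local Open Scope quotient_scope.
Local Open Scope ring_scope.

(** The obstacle is the number of special cases: odd and even $N$, and the indices $0$ and $\pm1$.
    They are absorbed by indexing with [key], which folds the indices $\pm1$ of the even case onto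
    $0$, and by dividing $r_j^2$ by a weight that for odd $N$ differs from $\omega_0$ at $j=0$; then
    both parities obey the same records [qplane] and [qframe]. These records mention no generators
    of $\mathcal{A}_N$, so they can be instantiated in the opposite algebra and with the momenta as
    coordinates. The conditions on $\bar\gamma_a\bar\gamma_{-a}$ make the momenta satisfy [qplane]
    again, with squared radii inverse to those of the coordinates up to $\Lambda^{-2}$ and a scalar;
    the same normalisation makes the diagonal images at $i$ and $-i$ inverse to each other. Since
    $\mathcal{A}_N$ is given by a presentation, $1\ne0$ is not established in it; the case of the
    zero ring is split off at the end. *)

Section Converse.
Variables (C : fieldType) (A : algType C).
Local Notation Ac := (GRing.converse A).

(** A frame in the opposite algebra is a frame with all products reversed; this is how [Lreal_x]
    comes out of [frame_cross]. *)
HB.instance Definition _ := GRing.Zmodule_isLmodule.Build C Ac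
  (@scalerA C A) (@scale1r C A) (@scalerDr C A)
  (fun v => @scalerDl C A v).

Lemma converse_scaleAl (c : C) (a b : Ac) : c *: (a * b) = (c *: a) * b.
Proof. exact: (@scalerAr C A). Qed.
Lemma converse_scaleAr (c : C) (a b : Ac) : c *: (a * b) = a * (c *: b).
Proof. exact: (@scalerAl C A). Qed.
HB.instance Definition _ :=
  GRing.Lmodule_isLalgebra.Build C Ac converse_scaleAl.
HB.instance Definition _ :=
  GRing.Lalgebra_isAlgebra.Build C Ac converse_scaleAr.
End Converse.

(** * Indices folded so that odd and even dimension look alike *)

Section Keys.
Variable N : nat.

(** For [N] odd this is [idx]. For [N] even every index moves one step towards 0, so that $\pm1$
    share the key 0 and become incomparable. The keys then fill an interval of integers without a
    gap, as telescoping sums require. *)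
Definition key (i : 'I_N) : int :=
  i%:Z - N./2%:Z + (~~ odd N && (i < N./2)%N)%:Z.

Lemma idx_key i : idx i = key i + (~~ odd N)%:Z * (if (i < N./2)%N then -1 else 1).
Proof. by rewrite /idx /key; case: ltnP => /=; lia. Qed.

Lemma key_rev i : key (rev_ord i) = - key i.
Proof. by rewrite /key /=; case: i => i /=; lia. Qed.

Lemma key_eq i j : key i = key j ->
  j = i \/ [/\ j = rev_ord i, key i = 0 & ~~ odd N].
Proof.
rewrite /key => H; case: (eqVneq (i : nat) j) => [/val_inj|]; first by left.
move=> ij; right; split; first apply/val_inj => /=; 
  move: H ij; case: i => i /= ?; case: j => j /= ?; lia.
Qed.

Lemma rev_fix i : (i == rev_ord i) = odd N && (key i == 0).
Proof.
by rewrite -val_eqE /key /=; case: i => i /= ?; lia.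
Qed.

Lemma key_leP (z : int) : (`|z| <= N.-1./2)%N -> (0 < N)%N -> exists i, key i = z.
Proof.
move=> zN N0.
pose m := (`|(z + N./2%:Z - (~~ odd N && (z < 0))%:Z)%R|)%N.
have mN : (m < N)%N by rewrite /m; lia.
by exists (Ordinal mN); rewrite /key /= /m; lia.
Qed.

Lemma key_le i : (`|key i| <= N.-1./2)%N.
Proof. by rewrite /key; case: i => i /=; lia. Qed.

(** The second disjunct is the pair $(-1,1)$ for [N] even, the only one that the order of keys does
    not see. *)
Lemma ltn_key (a b : 'I_N) :
  (a < b)%N = (key a < key b) || [&& ~~ odd N, key a == 0, (a < b)%N & b == rev_ord a].
Proof. by rewrite -val_eqE /key /=; case: a b => a /= ? [b /= ?]; lia. Qed.

Lemma key_ltW (a b : 'I_N) : key a < key b -> (a < b)%N.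
Proof. by rewrite [(a < b)%N]ltn_key => ->. Qed.

Lemma idx_odd i : odd N -> idx i = key i.
Proof. by rewrite /idx /key => ->; lia. Qed.

End Keys.

(** * The scalars $q^{-\rho_i}$ in terms of keys *)

Fact tau_key : unit. Proof. exact: tt. Qed.

Section Scalars.
Variables (C : fieldType) (N : nat) (qh : C).
Local Notation q := (qh ^+ 2).

(** Accounts for the half-integral part of $\rho_i$ for [N] odd. *)
Definition eta_ : C := if odd N then qh else 1.
(* Locked, so that rewriting with the laws of products does not unfold it.    *)
Definition tau_ (i : 'I_N) : C := locked_with tau_key
  (q ^ key i * (if 0 < key i then eta_^-1 else if key i < 0 then eta_ else 1)).

Lemma tauE i : tau_ i =
  q ^ key i * (if 0 < key i then eta_^-1 else if key i < 0 then eta_ else 1).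
Proof. by rewrite /tau_ unlock. Qed.

Lemma qrho_tau i : qh != 0 -> (qrho qh N (idx i))^-1 = tau_ i.
Proof.
move=> qh0; rewrite /qrho !tauE /eta_ -[qh ^+ 2]/(qh ^ 2%:Z) exprz_exp invr_expz.
have -> : - rho2 N (idx i) = 2%:Z * key i + (odd N)%:Z * (if 0 < key i then -1 else if key i < 0 then 1 else 0).
  rewrite /rho2 idx_key /key; case: i => i /= iN; case: ltnP => ? /=;
  case: sgzP => ?; case: ltrgtP => ?; case oN: (odd N) => /=; lia.
rewrite expfzDr //; congr (_ * _).
by case: (odd N); case: ltrgtP => _; rewrite ?mul1r ?mul0r ?expr0z ?invr1.
Qed.

Lemma eta_neq0 : qh != 0 -> eta_ != 0.
Proof. by rewrite /eta_; case: ifP => // _ _; exact: oner_neq0. Qed.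
Lemma tau_neq0 i : qh != 0 -> tau_ i != 0.
Proof.
move=> qh0; rewrite !tauE mulf_neq0 ?expfz_neq0 ?expf_neq0 //.
by do 2?case: ifP => _; rewrite ?invr_eq0 ?eta_neq0 ?oner_neq0.
Qed.
Lemma tau_rev i : qh != 0 -> tau_ (rev_ord i) = (tau_ i)^-1.
Proof.
move=> qh0; rewrite !tauE key_rev invfM invr_expz oppr_gt0 oppr_lt0; congr (_ * _).
by case: ltrgtP; rewrite ?invrK ?invr1.
Qed.
End Scalars.

Section ScalarsInv.
Variables (C : fieldType) (N : nat) (qh : C).
Lemma eta_inv : eta_ N qh^-1 = (eta_ N qh)^-1.
Proof. by rewrite /eta_; case: ifP; rewrite ?invr1. Qed.
Lemma tau_inv (i : 'I_N) : tau_ qh^-1 i = (tau_ qh i)^-1.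
Proof.
rewrite !tauE eta_inv invfM exprVn exprz_inv invr_expz; congr (_ * _).
by case: ltrgtP; rewrite ?invrK ?invr1.
Qed.
End ScalarsInv.

(** * Coordinates, momenta and telescoping sums *)

Definition frame_index (z : int) : nat := if 0 < z then `|z|.-1%N else `|z|%N.
(** Together with [frame_index] it is chosen so that the antiderivative [partial_norm], taken just
    below [h], equals [tau h * frame_coef] times [c (frame_index (key h))]. *)
Definition frame_coef (C : fieldType) (N : nat) (qh : C) (z : int) : C :=
  if 0 < z then qh ^- 2 else if z < 0 then -1 else - eta_ N qh.

Section Frames.
Variables (C : fieldType) (A : algType C) (N : nat) (qh : C).
Local Notation q := (qh ^+ 2).
Local Notation k := (q - q^-1).
Local Notation eta := (eta_ N qh).
Local Notation tau := (tau_ qh).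

(** [c j] stands for a squared radius divided by a weight. With this normalisation $x^{\pm i}x^{\mp
    i}$ is a combination of two neighbouring radii with coefficients $1$ and $-q^{\mp1}$. The family
    [c] is arbitrary because the momenta must satisfy the same record with $q$ inverted. *)
Record qplane (x : 'I_N -> A) (c : nat -> A) : Prop := Qplane {
  qp_lt : forall i j, key i < key j -> i != rev_ord j ->
    x i * x j = q *: (x j * x i);
  qp_neg : forall i, 0 < key i ->
    x (rev_ord i) * x i = c `|key i|%N - q *: c `|key i|.-1%N;
  qp_pos : forall i, 0 < key i ->
    x i * x (rev_ord i) = c `|key i|%N - q^-1 *: c `|key i|.-1%N;
  qp_zero : forall i, key i = 0 ->
    x i * x (rev_ord i) = (if odd N then qh + qh^-1 else 1) *: c 0%N }.

(** What is used of a single momentum $\lambda_h$ and of its bracket [D] with $x^h$. The last two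
    fields make $Dx^{-h}$ and $x^{-h}D$ exactly the boundary terms that close the telescoping sums
    below. *)
Record qframe (x : 'I_N -> A) (c : nat -> A) (h : 'I_N) (lam D : A) : Prop :=
  Qframe {
  fr_lt : forall i, key i < key h -> lam * x i = q ^+ 2 *: (x i * lam);
  fr_ge : forall i, key h <= key i -> i != h -> lam * x i = x i * lam;
  fr_comm : lam * x h - x h * lam = D;
  fr_xD : forall i,
    (q * (if i == h then q else 1) * (if i == rev_ord h then q^-1 else 1))
      *: (x i * D) = D * x i;
  fr_Dx : D * x (rev_ord h) =
    - ((1 - q ^- 2) * frame_coef N qh (key h))
      *: (lam * c (frame_index (key h)));
  fr_Dx' : x (rev_ord h) * D =
    ((1 - q ^+ 2) * frame_coef N qh^-1 (key h))
      *: (c (frame_index (key h)) * lam) }.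

Hypotheses (N_gt0 : (0 < N)%N) (qh0 : qh != 0).
Let q0 : q != 0. Proof. by rewrite expf_neq0. Qed.

Section Plane.
Variables (x : 'I_N -> A) (c : nat -> A).
Hypothesis xc : qplane x c.

(** An antiderivative, by [pair_sum], of the sum of $q^{-\rho_d}x^dx^{-d}$ over the indices of a
    given key. It need not vanish below the least key: the constant of summation is chosen so that
    every value is a multiple of a single [c j]. *)
Definition partial_norm (z : int) : A :=
  if 0 <= z then (q ^ z * eta^-1) *: c `|z|%N
  else - (q ^ (z + 1) * eta) *: c `|z|.-1%N.
Local Notation F := partial_norm.

Lemma frame_partial_norm (h : 'I_N) :
  F (key h - 1) =
    (tau h * frame_coef N qh (key h)) *: c (frame_index (key h)).
Proof.
have e0 := eta_neq0 N qh0; rewrite /F !tauE /frame_coef /frame_index.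
case: (ltrgtP (key h) 0) => [h0|h0|->].
- rewrite ifF; last by lia.
  by rewrite subrK mulrN1; congr (_ *: c _); lia.
- rewrite ifT; last by lia.
  have -> : (`|key h - 1|)%N = (`|key h|.-1)%N by lia.
  by congr (_ *: _); rewrite expfzDr // mulrAC.
- by rewrite expr0z !mul1r.
Qed.

Lemma frame_partial_normN (h : 'I_N) :
  F (- key h) =
    - ((tau h)^-1 * frame_coef N qh^-1 (key h)) *: c (frame_index (key h)).
Proof.
have e0 := eta_neq0 N qh0; rewrite /F !tauE /frame_coef /frame_index eta_inv.
rewrite invfM invr_expz oppr_ge0.
case: (ltrgtP (key h) 0) => [h0|h0|->].
- by rewrite mulrN1 opprK abszN.
- by rewrite invrK expfzDr // expr1z exprVn invrK abszN mulrAC.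
- by rewrite expr0z invr1 !mul1r opprK.
Qed.

Lemma pair_sum z : (`|z| <= N.-1./2)%N ->
  \sum_(d : 'I_N | key d == z) tau d *: (x d * x (rev_ord d)) = F z - F (z - 1).
Proof.
move=> zK; have [d dz] := key_leP zK N_gt0.
have e0 := eta_neq0 N qh0.
have <- : F (key d - 1) = F (z - 1) by rewrite dz.
rewrite frame_partial_norm -dz !tauE /F /frame_coef /frame_index.
case: (ltrgtP (key d) 0) => [d0|d0|d0].
- rewrite (big_pred1 d) => [|i]; last first.
    apply/eqP/eqP => [/esym/key_eq[->//|[_]]|->//]; lia.
  have r0 : 0 < key (rev_ord d) by rewrite key_rev; lia.
  have := qp_neg xc r0; rewrite rev_ordK => ->.
  rewrite key_rev !tauE ifF ?d0; last by lia.
  rewrite abszN mulrN1 scalerBr scalerA !scaleNr opprK addrC.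
  by rewrite expfzDr // expr1z mulrAC.
- rewrite (big_pred1 d) => [|i]; last first.
    apply/eqP/eqP => [/esym/key_eq[->//|[_]]|->//]; lia.
  rewrite (qp_pos xc d0) !tauE d0 scalerBr scalerA; congr (_ - _); congr (_ *: _); ring.
- rewrite d0 /= expr0z !mul1r.
  have [oN|eN] := boolP (odd N).
    rewrite (big_pred1 d) => [|i]; last first.
      by apply/eqP/eqP => [|->//]; rewrite -{1}d0 => /esym/key_eq[->//|[_]]; rewrite oN.
    rewrite (qp_zero xc d0) !tauE d0 /= expr0z mul1r scale1r oN /eta_ oN.
    by rewrite scaleNr opprK -scalerDl addrC.
  (* For [N] even the key 0 belongs to both indices $\pm1$, and the jump of [F] there is twice
     [c 0]. *)
  have rd : rev_ord d != d by rewrite eq_sym rev_fix (negbTE eN).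
  rewrite (bigD1 d) ?d0 //= (big_pred1 (rev_ord d)) => [|i]; last first.
    apply/andP/eqP => [[/eqP]|-> //]; last by rewrite key_rev d0 oppr0 eqxx rd.
    by rewrite -{1}d0 => /esym/key_eq[-> /eqP//|[->]].
  have d0' : key (rev_ord d) = 0 by rewrite key_rev d0 oppr0.
  rewrite (qp_zero xc d0) (qp_zero xc d0') !tauE d0 d0' /= expr0z mul1r !scale1r.
  by rewrite /eta_ (negbTE eN) invr1 scaleN1r opprK scale1r.
Qed.

(** The lower end is excluded from the sum, so [a] may lie one below the least key. *)
Lemma interval_sum (a : int) n : (- (N.-1./2)%:Z - 1 <= a) ->
  (a + n%:Z <= (N.-1./2)%:Z) ->
  \sum_(d : 'I_N | a < key d <= a + n%:Z) tau d *: (x d * x (rev_ord d)) =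
  F (a + n%:Z) - F a.
Proof.
elim: n => [|n IH] aK nK.
  by rewrite addr0 subrr big_pred0 // => i; lia.
rewrite (bigID (fun d => key d == a + n.+1%:Z)) /=.
rewrite (eq_bigl (fun d => key d == a + n.+1%:Z)) => [|i]; last by lia.
rewrite pair_sum; last by lia.
rewrite (eq_bigl (fun d => a < key d <= a + n%:Z)) => [|i]; last by lia.
rewrite IH; [|lia..].
have -> : a + n.+1%:Z - 1 = a + n%:Z by lia.
by rewrite addrA subrK.
Qed.

Section Frame.
Variables (h : 'I_N) (lam D : A).
Hypothesis fr : qframe x c h lam D.
Local Notation E := (fun m => lam * x m - x m * lam).

Lemma frame_comm_lt (m : 'I_N) : key m < key h ->
  lam * x m - x m * lam = (1 - q ^- 2) *: (lam * x m).
Proof.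
move=> mh; rewrite scalerBl scale1r (fr_lt fr mh) scalerA mulVf ?expf_neq0 //.
by rewrite scale1r.
Qed.

Lemma frame_comm_ge (m : 'I_N) : key h <= key m -> m != h ->
  lam * x m - x m * lam = 0.
Proof. by move=> mh nm; rewrite (fr_ge fr mh nm) subrr. Qed.

(** Below [h] the sum telescopes. Its upper end is cancelled by the term $d=h$, which [fr_Dx]
    rewrites as a multiple of $\lambda_h$ times [F (key h - 1)]; the terms beyond vanish. *)
Lemma tail_sum_lt (m : 'I_N) : key m < key h ->
  \sum_(d : 'I_N | key m < key d) tau d *: (E d * x (rev_ord d)) =
  - (1 - q ^- 2) *: (lam * F (key m)).
Proof.
move=> mh; rewrite (bigID (fun d => key d < key h)) /=.
rewrite [X in _ + X](bigD1 h) /=; last by rewrite mh ltxx.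
rewrite (fr_comm fr) [X in _ + (_ + X)]big1 ?addr0; last first.
  move=> d /andP[/andP[_]]; rewrite -leNgt => hd dh.
  by rewrite frame_comm_ge // mul0r scaler0.
under eq_bigr => d /andP[_ dh]
  do rewrite (frame_comm_lt dh) -scalerAl scalerA mulrC -scalerA -mulrA scalerAr.
rewrite -scaler_sumr -mulr_sumr.
have kh : key h - 1 = key m + (absz (key h - 1 - key m)%R)%:Z by lia.
have -> : \sum_(d | (key m < key d) && (key d < key h))
    tau d *: (x d * x (rev_ord d)) = F (key h - 1) - F (key m).
  rewrite kh -interval_sum -?kh; first by apply: eq_bigl => d; lia.
    by have := key_le m; lia.
  by have := key_le h; lia.
rewrite (fr_Dx fr) frame_partial_norm mulrBr -scalerAr scalerBr !scalerA.
by rewrite mulrN !scaleNr [tau h * (_ * _)]mulrCA addrAC subrr add0r.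
Qed.

Lemma tail_sum_ge (m : 'I_N) : key h <= key m ->
  \sum_(d : 'I_N | key m < key d) tau d *: (E d * x (rev_ord d)) = 0.
Proof.
move=> hm; apply: big1 => d md; rewrite frame_comm_ge ?mul0r ?scaler0 //.
  by lia.
by apply: contraTneq md => ->; lia.
Qed.

(** Exchanges the two factors of a conjugate pair at the cost of a partial norm. This is the content
    of the cross relation at $i=-m$, the one case where the last sum of the braid matrix
    contributes. *)
Lemma partial_norm_local (m : 'I_N) :
  (if key m < 0 then q else q^-1) *: (x (rev_ord m) * x m) =
  (if m == rev_ord m then 1 else q) *: (x m * x (rev_ord m))
  - (k * (tau m)^-1) *: F (key m).
Proof.
have e0 := eta_neq0 N qh0; rewrite /F !tauE rev_fix.
have Z0 : q ^ key m != 0 by rewrite expfz_neq0.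
case: (ltrgtP (key m) 0) => [m0|m0|m0].
- rewrite andbF.
  have r0 : 0 < key (rev_ord m) by rewrite key_rev; lia.
  have := qp_neg xc r0; have := qp_pos xc r0; rewrite rev_ordK => -> ->.
  rewrite key_rev abszN expfzDr // expr1z.
  rewrite !scalerBr !scalerA -addrA -opprD -scalerDl; congr (_ - _ *: _).
  by field; apply/and3P.
- rewrite andbF (qp_neg xc m0) (qp_pos xc m0).
  rewrite !scalerBr !scalerA addrAC -scalerBl mulVf // mulfV //.
  congr (_ *: _ - _); by field; apply/and3P.
- rewrite andbT m0 expr0z !mul1r invr1 mulr1 scalerA.
  have m0' : key (rev_ord m) = 0 by rewrite key_rev m0.
  have := qp_zero xc m0'; rewrite (qp_zero xc m0) rev_ordK => ->.
  rewrite !scalerA -scalerBl /eta_; congr (_ *: _); case: ifP => _; last by rewrite divr1; field.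
  by field.
Qed.

(** The right-hand side has the shape of [sum_Rhat_mid]. If [key h <= key m], only $m=h$ survives
    and the claim is [fr_xD]. If [key m < key h], the bracket at [m] is a multiple of $\lambda x^m$,
    and what remains is a relation between coordinates multiplied by $\lambda$. *)
Lemma frame_cross (i m : 'I_N) :
  q *: (x i * E m) =
    ((if i == rev_ord m then q else 1) * (if i == m then q^-1 else 1))
       *: (E m * x i)
    - (if key m < key i then k else 0) *: (E i * x m)
    + (if i == rev_ord m then k * (tau m)^-1 else 0) *:
        \sum_(d : 'I_N | key m < key d) tau d *: (E d * x (rev_ord d)).
Proof.
have kE : q * (1 - q ^- 2) = k by field.
case: (ltrP (key m) (key h)) => [mh|hm]; last first.
  rewrite tail_sum_ge // scaler0 addr0.
  have -> : (if key m < key i then k else 0) *: (E i * x m) = 0.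
    case: ifP => mi; last by rewrite scale0r.
    rewrite frame_comm_ge ?mul0r ?scaler0 //; first by lia.
    by apply: contraTneq mi => ->; lia.
  rewrite subr0; have [->|nm] := eqVneq m h; last first.
    by rewrite frame_comm_ge // mulr0 mul0r !scaler0.
  rewrite (fr_comm fr) -(fr_xD fr) scalerA; congr (_ *: _).
  by do 2!case: ifP => _; field.
rewrite (tail_sum_lt mh) (frame_comm_lt mh) -scalerAl -!scalerAr !scalerA.
have [->{i}|im] := eqVneq i (rev_ord m).
  have e1 : ((if rev_ord m == m then q^-1 else 1) * q) =
            (if m == rev_ord m then 1 else q).
    by rewrite eq_sym; case: eqP; rewrite ?mulVf ?mul1r.
  rewrite [q * (if _ then _ else _)]mulrC e1 addrAC.
  rewrite [X in _ = X *: _ + _ - _]mulrC [k / tau m * _]mulrC mulNr scaleNr.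
  rewrite -!(scalerA (1 - q ^- 2)) -scalerBr -[lam * x m * _]mulrA.
  rewrite !(scalerAr _ lam) -mulrBr -partial_norm_local -scalerAr.
  (* For [key m < 0] the bracket at $-m$ occurs on the right; it stays unfolded, since $-m$ may lie
     beyond [h]. Otherwise it is absent, and [key (rev_ord m) <= key m < key h] lets $\lambda$ pass
     $x^{-m}$. *)
  rewrite scalerA key_rev; case: ltrP => m0.
    rewrite ifT; last by lia.
    rewrite [_ * q]mulrC kE mulrBl scalerBr !mulrA.
    by rewrite opprB addrCA subrr addr0.
  rewrite ifF; last by lia.
  rewrite scale0r subr0 !mulrA (fr_lt fr); last by rewrite key_rev; lia.
  by rewrite -scalerAl scalerA mulrA; congr (_ *: _); field.
rewrite mul0r scale0r addr0 kE mul1r.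
have [->{i im}|nim] := eqVneq i m.
  rewrite ltxx scale0r subr0 !mulrA (fr_lt fr mh) -!scalerAl scalerA.
  by congr (_ *: _); field.
have [im'|mi'|e] := ltrgtP (key i) (key m).
3: by case: (key_eq (esym e)) => [/eqP|[/eqP]]; rewrite ?(negbTE nim) ?(negbTE im).
- have -> : lam * x m * x i = q^-1 *: (lam * x i * x m).
    by rewrite -!mulrA (qp_lt xc im') // -scalerAr scalerA mulVf // scale1r.
  rewrite scale0r subr0 mulrA (fr_lt fr); last exact: lt_trans mh.
  by rewrite -scalerAl !scalerA; congr (_ *: _); field.
- rewrite -(mulrA lam) (qp_lt xc mi') ?mul1r; last first.
    by apply: contraNneq im => ->; rewrite rev_ordK.
  rewrite -scalerAr scalerA [_ * q]mulrC kE mulrBl scalerBr !mulrA.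
  by rewrite opprB addrCA subrr addr0.
Qed.

Lemma frame_Dx_norm :
  D * x (rev_ord h) = - ((1 - q ^- 2) * (tau h)^-1) *: (lam * F (key h - 1)).
Proof.
rewrite (fr_Dx fr) frame_partial_norm -scalerAr scalerA; congr (_ *: _).
by rewrite mulNr -mulrA mulKf ?tau_neq0.
Qed.
End Frame.

(** In the order of keys the terms live on $-b\le m\le a$. For $b=-a$ one term survives. Otherwise
    either all terms vanish, or the interior telescopes and is cancelled by the end terms $m=a$ and
    $m=-b$, evaluated with [fr_Dx] and [fr_Dx']. *)
Lemma frame_metric (a b : 'I_N) (la Da lb Db : A) :
  qframe x c a la Da -> qframe x c b lb Db ->
  \sum_m tau m *: ((la * x m - x m * la) *
                   (lb * x (rev_ord m) - x (rev_ord m) * lb)) =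
  if b == rev_ord a then tau a *: (Da * Db) else 0.
Proof.
move=> fa fb.
have xDb : x (rev_ord b) * Db = ((q ^+ 2 - 1) * tau b) *: (F (- key b) * lb).
  rewrite (fr_Dx' fb) frame_partial_normN -scalerAl scalerA; congr (_ *: _).
  by rewrite mulrN -mulrA mulVKf ?tau_neq0 // -mulNr opprB.
have [ba|nba] := eqVneq b (rev_ord a).
  rewrite (bigD1 a) //= (fr_comm fa) -{1}[rev_ord a]ba -{1}[rev_ord a]ba.
  rewrite (fr_comm fb) big1 ?addr0 // => m ma.
  have [mlt|mge] := ltrP (key m) (key a); last first.
    by rewrite (frame_comm_ge fa mge ma) mul0r scaler0.
  rewrite (frame_comm_ge fb) ?mulr0 ?scaler0 // ba ?key_rev; first by lia.
  by rewrite (inj_eq rev_ord_inj).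
have nab : rev_ord b != a by apply: contraNneq nba => <-; rewrite rev_ordK.
have [lt|ge] := ltrP (key (rev_ord b)) (key a); last first.
  apply: big1 => m _; have [mlt|mge] := ltrP (key m) (key a).
    rewrite (frame_comm_ge fb) ?mulr0 ?scaler0 //.
      by move: ge; rewrite !key_rev; lia.
    by apply: contraTneq mlt => mb; rewrite -leNgt -[m]rev_ordK mb.
  have [->|ma] := eqVneq m a; last by rewrite (frame_comm_ge fa mge ma) mul0r scaler0.
  rewrite (frame_comm_ge fb) ?mulr0 ?scaler0 //; last by rewrite eq_sym.
  by move: ge; rewrite !key_rev; lia.
rewrite (bigD1 a) //= (bigD1 (rev_ord b)) //= rev_ordK.
rewrite (fr_comm fa) (fr_comm fb) (frame_comm_lt fa lt).
have lt' : key (rev_ord a) < key b by move: lt; rewrite !key_rev; lia.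
rewrite (frame_comm_lt fb lt').
rewrite (bigID (fun m => key (rev_ord b) < key m < key a)) /=.
rewrite [X in _ + (_ + (_ + X))]big1 ?addr0; last first.
  move=> m /andP[/andP[ma mb]].
  case: (ltrP (key m) (key a)) => [mlt|mge _]; last first.
    by rewrite (frame_comm_ge fa mge ma) mul0r scaler0.
  rewrite andbT -leNgt => mge; rewrite (frame_comm_ge fb) ?mulr0 ?scaler0 //.
    by move: mge; rewrite !key_rev; lia.
  by apply: contraNneq mb => <-; rewrite rev_ordK.
rewrite (eq_bigl (fun m => key (rev_ord b) < key m < key a)); last first.
  move=> m; case: (eqVneq m a) => [->|_]; first by rewrite ltxx !andbF.
  by case: (eqVneq m (rev_ord b)) => [->|_] //; rewrite ltxx.
have -> : \sum_(m | key (rev_ord b) < key m < key a)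
    tau m *: ((la * x m - x m * la) * (lb * x (rev_ord m) - x (rev_ord m) * lb))
    = ((1 - q ^- 2) * (1 - q ^- 2) * q ^+ 2) *:
       (la * (F (key a - 1) - F (key (rev_ord b))) * lb).
  have ka : key a - 1 =
      key (rev_ord b) + (absz (key a - 1 - key (rev_ord b))%R)%:Z by lia.
  have := @interval_sum (key (rev_ord b)) (absz (key a - 1 - key (rev_ord b))%R).
  rewrite -ka => <-; last first.
  - by have := key_le a; lia.
  - by have := key_le (rev_ord b); lia.
  rewrite mulr_sumr mulr_suml scaler_sumr; apply: eq_big => m; first by lia.
  move=> /andP[mb ma]; rewrite (frame_comm_lt fa ma) (frame_comm_lt fb); last first.
    by move: mb; rewrite !key_rev; lia.
  rewrite (fr_lt fb); last by move: mb; rewrite !key_rev; lia.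
  rewrite -!(scalerAl, scalerAr) !scalerA.
  by congr (_ *: _); [move: (tau_ qh m) => t; ring | rewrite !mulrA].
rewrite (fr_lt fb lt') -scalerAr -scalerAr mulrA (frame_Dx_norm fa).
rewrite -!scalerAl -(mulrA la (x _)) xDb -scalerAr !scalerA key_rev tau_rev //.
(* [g] is the factor of the interior sum; the end terms $m=a$ and $m=-b$ carry [- g] and [g],
   against [F (key a - 1)] and [F (- key b)]. *)
pose g := (1 - q ^- 2) * (1 - q ^- 2) * q ^+ 2; rewrite -/g.
have t0 := tau_neq0 a qh0; have t0' := tau_neq0 b qh0.
have -> : tau a * ((1 - q ^- 2) * q ^+ 2) * - ((1 - q ^- 2) / tau a) = - g.
  by rewrite /g; move: (tau_ qh a) t0 => t t0; field; rewrite t0 qh0.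
have -> : (tau b)^-1 * (1 - q ^- 2) * ((q ^+ 2 - 1) * tau b) = g.
  by rewrite /g; move: (tau_ qh b) t0' => t t0'; field; rewrite t0' qh0.
by rewrite -scalerDr mulrA -mulrDl mulrBr addrCA subrr addr0 scaleNr addNr.
Qed.
End Plane.
End Frames.

(** * Reversal of products with $q$ inverted *)

Section FrameConverse.
Variables (C : fieldType) (A : algType C) (N : nat) (qh : C).
Hypothesis (qh0 : qh != 0).
Local Notation Ac := (GRing.converse A).

Lemma qplane_converse (x : 'I_N -> A) c :
  qplane qh x c -> qplane (A := Ac) qh^-1 x c.
Proof.
have q0 : qh ^+ 2 != 0 by rewrite expf_neq0.
case=> lt neg pos zero; split=> [i j ij nij|i i0|i i0|i i0]; rewrite ?exprVn.
- have E : x j * x i = (qh ^+ 2)^-1 *: (x i * x j).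
    by rewrite (lt _ _ ij nij) scalerA mulVf // scale1r.
  exact: E.
- exact: pos.
- by rewrite invrK; exact: neg.
- have := zero (rev_ord i); rewrite key_rev i0 rev_ordK => /(_ erefl).
  by rewrite invrK addrC.
Qed.

(** The sign of [lam] keeps the bracket [D] unchanged, and the fields [fr_Dx] and [fr_Dx'] change
    places. *)
Lemma qframe_converse (x : 'I_N -> A) c h lam D :
  qframe qh x c h lam D -> qframe (A := Ac) qh^-1 x c h (- lam) D.
Proof.
have q0 : qh ^+ 2 != 0 by rewrite expf_neq0.
case=> lt ge comm xD Dx xD'; split=> [i ih|i hi ih||i||]; rewrite ?exprVn ?invrK.
- have E : x i * - lam = (qh ^+ 2) ^- 2 *: (- lam * x i).
    by rewrite mulrN mulNr lt // scalerN scalerA mulVf ?expf_neq0 // scale1r.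
  exact: E.
- have E : x i * - lam = - lam * x i by rewrite mulrN mulNr ge.
  exact: E.
- have E : x h * - lam - - lam * x h = D by rewrite mulrN mulNr opprK addrC.
  exact: E.
- have E : ((qh ^+ 2)^-1 * (if i == h then (qh ^+ 2)^-1 else 1) *
     (if i == rev_ord h then qh ^+ 2 else 1)) *: (D * x i) = x i * D.
    rewrite -xD scalerA -[RHS]scale1r; congr (_ *: _).
    by do 2!case: ifP => _; field.
  exact: E.
- have E : x (rev_ord h) * D =
     - ((1 - qh ^+ 2 ^+ 2) * frame_coef N qh^-1 (key h)) *:
       (c (frame_index (key h)) * - lam) by rewrite mulrN scaleNr scalerN opprK.
  exact: E.
- have E : D * x (rev_ord h) =
     ((1 - qh ^+ 2 ^- 2) * frame_coef N qh (key h)) *: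
       (- lam * c (frame_index (key h))).
    by rewrite Dx mulNr scalerN scaleNr.
  exact: E.
Qed.
End FrameConverse.

(** * The braid matrix and its contractions *)

Section BraidMatrix.
Variables (C : fieldType) (N : nat) (qh : C).
Local Notation q := (qh ^+ 2).
Local Notation k := (q - q^-1).
Local Notation tau := (tau_ qh).
Hypothesis (qh0 : qh != 0).

Lemma tensor_delta (i j u v a b c d : 'I_N) :
  tensor (delta_mx i j) (delta_mx u v) a b c d =
  [&& a == i, c == j, b == u & d == v]%:R :> C.
Proof. by rewrite /tensor !mxE -natrM mulnb -andbA. Qed.

Lemma sum_delta (V : lmodType C) (I : finType) (P : pred I) (Q : pred I)
    (F : I -> C) (G : I -> V) u :
  (forall i, Q i -> i = u) ->
  \sum_(i | P i) (F i * (Q i)%:R) *: G i =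
  (F u * (P u && Q u)%:R) *: G u.
Proof.
move=> Qu; rewrite big_mkcond (bigD1 u) //= big1 ?addr0 => [|i iu].
  by case: (P u); rewrite //= mulr0 scale0r.
case: (P i) => //; rewrite (_ : Q i = false) ?mulr0 ?scale0r //.
by apply: contraNF iu => /Qu ->.
Qed.

Lemma sum_delta2 (V : lmodType C) (P Q : 'I_N -> 'I_N -> bool)
    (F : 'I_N -> 'I_N -> C) (G : 'I_N -> 'I_N -> V) u v :
  (forall i j, Q i j -> i = u /\ j = v) ->
  \sum_i \sum_(j | P i j) (F i j * (Q i j)%:R) *: G i j =
  (F u v * (P u v && Q u v)%:R) *: G u v.
Proof.
move=> Quv; rewrite pair_big_dep /=.
apply: (@sum_delta _ _ (fun p => P p.1 p.2) (fun p => Q p.1 p.2)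
  (fun p => F p.1 p.2) (fun p => G p.1 p.2) (u, v)).
by case=> i j /Quv[/= -> ->].
Qed.

(** The product of two conditionals also covers $a=b=0$ for [N] odd, where $q$ and $q^{-1}$ cancel
    to the coefficient 1 of $E_{00}\otimes E_{00}$. *)
Lemma RhatE (a b c d : 'I_N) :
  Rhat q qh a b c d =
    ((if a == b then q else 1) * (if a == rev_ord b then q^-1 else 1))
      * ((a == d) && (b == c))%:R
    + k * [&& key a < key b, a == c & b == d]%:R
    - (k * (tau a / tau d)) * [&& key a < key d, b == rev_ord a & c == rev_ord d]%:R.
Proof.
have sd1 (P Q : pred 'I_N) u : (forall i, Q i -> i = u) ->
    \sum_(i | P i) (Q i)%:R = (P u && Q u)%:R :> C.
  move=> Qu; rewrite -[RHS]mul1r -[RHS]mulr1.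
  rewrite -[RHS](@sum_delta C^o _ P Q (fun=> 1) (fun=> 1)) //.
  by apply: eq_bigr => i _; rewrite mul1r [_ *: _]mulr1.
have sd2 (P Q : 'I_N -> 'I_N -> bool) F u v :
    (forall i j, Q i j -> i = u /\ j = v) ->
    \sum_i \sum_(j | P i j) F i j * (Q i j)%:R =
    F u v * (P u v && Q u v)%:R :> C.
  move=> Quv; rewrite -[RHS]mulr1.
  rewrite -[RHS](@sum_delta2 C^o P Q F (fun _ _ => 1)) //.
  by apply: eq_bigr => i _; apply: eq_bigr => j _; rewrite [_ *: _]mulr1.
rewrite /Rhat; set E := @delta_mx _ _ _.
rewrite (eq_bigr _ (fun i _ => tensor_delta _ _ _ _ _ _ _ _)) (sd1 _ _ a); last first.
  by move=> i /andP[/eqP].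
rewrite [X in _ + X + _ + _](eq_bigr (fun i => \sum_(j | (i != j) && (i != rev_ord j) || (idx i == 0) && (idx j == 0)) 1 * [&& a == i, c == j, b == j & d == i]%:R)); last first.
  by move=> i _; apply: eq_bigr => j _; rewrite tensor_delta mul1r.
rewrite (sd2 _ (fun i j => [&& a == i, c == j, b == j & d == i]) _ a b) ?mul1r; last first.
  by move=> i j /and4P[/eqP -> _ /eqP ->].
rewrite [X in _ + _ * X + _ = _](eq_bigr _ (fun i _ => tensor_delta _ _ _ _ _ _ _ _)) (sd1 _ _ a); last first.
  by move=> i /andP[/eqP].
rewrite [X in _ + _ * (X - _) = _](eq_bigr (fun i => \sum_(j | idx i < idx j) 1 * [&& a == i, c == i, b == j & d == j]%:R)); last first.
  by move=> i _; apply: eq_bigr => j _; rewrite tensor_delta mul1r.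
rewrite (sd2 _ (fun i j => [&& a == i, c == i, b == j & d == j]) _ a b) ?mul1r; last first.
  by move=> i j /and4P[/eqP -> _ /eqP ->].
rewrite [X in _ + _ * (_ - X) = _](eq_bigr (fun i => \sum_(j | idx i < idx j) ((qrho qh N (idx i))^-1 * qrho qh N (idx j)) * [&& a == i, c == rev_ord j, b == rev_ord i & d == j]%:R)); last first.
  by move=> i _; apply: eq_bigr => j _; rewrite tensor_delta.
rewrite (sd2 _ (fun i j => [&& a == i, c == rev_ord j, b == rev_ord i & d == j]) _ a d); last first.
  by move=> i j /and4P[/eqP -> _ _ /eqP ->].
rewrite -[qrho _ _ (idx d)]invrK !qrho_tau //.
rewrite !eqxx /= !idx_lt (ltn_key a b) (ltn_key a d) andbT /k_.
have idx0 (i : 'I_N) : (idx i == 0) = (i == rev_ord i).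
  by rewrite -val_eqE /= /idx; case: i => i /=; lia.
rewrite -[RHS]addrA; congr (_ + _).
  rewrite !idx0 [a == d]eq_sym [b == c]eq_sym [a == rev_ord b]eq_sym.
  have -> : (rev_ord b == a) = (b == rev_ord a).
    by rewrite -(inj_eq rev_ord_inj) rev_ordK.
  have [_|_] := eqVneq d a; last by rewrite !andbF !mulr0 !addr0.
  rewrite !andbT /=; have [->|ab] := eqVneq a b.
    have [_|_] := eqVneq b (rev_ord b).
      by rewrite /= !mulr0 add0r addr0 mulfV ?expf_neq0 // mul1r.
    by rewrite /= !andbF mulr0 !addr0 mulr1 andbT.
  rewrite /= !andbF mulr0 add0r mul1r.
  have [ba|_] := eqVneq b (rev_ord a); last by rewrite !andbF mulr0 addr0 mul1r.
  have [aE|_] := eqVneq a (rev_ord a); first by rewrite ba -aE eqxx in ab.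
  by rewrite ba /= add0r andbT.
(* The pair $a=-1$, $y=1$ for [N] even is ordered by [idx] but not by [key]. It occurs once in each
   of the two sums with factor $k$, and the contributions cancel because [tau] is 1 at key 0. *)
pose X (y : 'I_N) := [&& ~~ odd N, key a == 0, (a < y)%N & y == rev_ord a].
have X0 y : key a < key y -> X y = false.
  move=> ay; apply/negP => /and4P[_ /eqP a0 _ /eqP yE].
  by move: ay; rewrite yE key_rev a0.
have orX y u : (((key a < key y) || X y) && u)%:R =
    ((key a < key y) && u)%:R + (X y && u)%:R :> C.
  by case: (boolP (key a < key y)) => [/X0 ->|_] /=; rewrite ?addr0 ?add0r.
have eX : (X b && ((c == a) && (d == b)))%:R =
    tau a / tau d * (X d && ((c == rev_ord d) && (b == rev_ord a)))%:R.
  rewrite /X; have [->|bra] := eqVneq b (rev_ord a); last by rewrite !andbF mulr0.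
  have [->|dra] := eqVneq d (rev_ord a); last by rewrite !andbF mulr0.
  rewrite rev_ordK; have [a0|_] := eqVneq (key a) 0; last by rewrite !andbF mulr0.
  rewrite tau_rev // invrK !tauE a0 ltxx expr0z !mul1r.
  by rewrite !andbT.
rewrite -/(X b) -/(X d) !orX eX [a == c]eq_sym [b == d]eq_sym.
rewrite [(b == rev_ord a) && (c == rev_ord d)]andbC; ring.
Qed.

Section Contractions.
Variables (V : lmodType C) (T : 'I_N -> 'I_N -> V).

Lemma sum_delta_all (Q : 'I_N -> 'I_N -> bool) (F : 'I_N -> 'I_N -> C) u v :
  (forall i j, Q i j -> i = u /\ j = v) ->
  \sum_i \sum_j (F i j * (Q i j)%:R) *: T i j =
  (if Q u v then F u v else 0) *: T u v.
Proof.
move=> Quv; rewrite (@sum_delta2 V (fun _ _ => true) Q F T u v) //=.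
by case: (Q u v); rewrite ?mulr1 ?mulr0.
Qed.

Lemma sum_Rhat_split (R : 'I_N -> 'I_N -> C) (R1 R2 R3 : 'I_N -> 'I_N -> C) :
  (forall i j, R i j = R1 i j + R2 i j - R3 i j) ->
  \sum_i \sum_j R i j *: T i j =
  \sum_i \sum_j R1 i j *: T i j + \sum_i \sum_j R2 i j *: T i j
  - \sum_i \sum_j R3 i j *: T i j.
Proof.
move=> RE; rewrite -big_split -sumrB; apply: eq_bigr => i _ /=.
rewrite -big_split -sumrB; apply: eq_bigr => j _ /=.
by rewrite RE scalerBl scalerDl.
Qed.

(** Of the three contractions, [sum_Rhat_mid] serves the cross relation; [sum_Rhat_row] and
    [sum_Rhat_col] serve the passage of $\mathcal{L}^+$ across momenta and across coordinates in the
    RLL relation. *)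
Lemma sum_Rhat_row a b :
  \sum_c \sum_d Rhat q qh a b c d *: T c d =
    ((if a == b then q else 1) * (if a == rev_ord b then q^-1 else 1)) *: T b a
    + (if key a < key b then k else 0) *: T a b
    - (if b == rev_ord a then k * tau a else 0) *:
        \sum_(d : 'I_N | key a < key d) (tau d)^-1 *: T (rev_ord d) d.
Proof.
rewrite (sum_Rhat_split (fun c d => RhatE a b c d)).
congr (_ + _ - _).
- rewrite (@sum_delta_all (fun c d => (a == d) && (b == c)) (fun _ _ => _) b a) ?eqxx //.
  by move=> c d /andP[/eqP-> /eqP->].
- rewrite (@sum_delta_all (fun c d => [&& key a < key b, a == c & b == d]) (fun _ _ => _) a b).
    by rewrite !eqxx !andbT.
  by move=> c d /and3P[_ /eqP-> /eqP->].
rewrite exchange_big /= scaler_sumr [RHS]big_mkcond /=; apply: eq_bigr => d _.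
rewrite (@sum_delta V _ predT (fun c => [&& key a < key d, b == rev_ord a & c == rev_ord d])
  (fun=> _) _ (rev_ord d)) => [|c /and3P[_ _ /eqP//]].
rewrite eqxx andbT /=; case: (key a < key d); last by rewrite mulr0 scale0r.
by case: (b == rev_ord a); rewrite ?mulr0 ?scale0r // mulr1 mulrA scalerA.
Qed.

End Contractions.

Section Contractions2.
Variables (V : lmodType C) (T : 'I_N -> 'I_N -> V).

Lemma sum_Rhat_mid i b :
  \sum_c \sum_j Rhat q qh c i j b *: T c j =
    ((if b == i then q else 1) * (if b == rev_ord i then q^-1 else 1)) *: T b i
    + (if i == b then k else 0) *: \sum_(c : 'I_N | key c < key i) T c c
    - (if key (rev_ord i) < key b then k * (tau (rev_ord i) / tau b) else 0) *:
        T (rev_ord i) (rev_ord b).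
Proof.
rewrite (sum_Rhat_split _ (fun c j => RhatE c i j b)).
congr (_ + _ - _).
- rewrite (@sum_delta_all _ T (fun c j => (c == b) && (i == j))
    (fun c j => (if c == i then q else 1) * (if c == rev_ord i then q^-1 else 1)) b i) ?eqxx //.
  by move=> c d /andP[/eqP-> /eqP->].
- rewrite scaler_sumr [RHS]big_mkcond /=; apply: eq_bigr => c _.
  rewrite (@sum_delta V _ predT (fun j => [&& key c < key i, c == j & i == b])
    (fun=> _) _ c) => [|j /and3P[_ /eqP//]].
  rewrite eqxx /=; case: (key c < key i); last by rewrite mulr0 scale0r.
  by case: (i == b); rewrite ?mulr0 ?scale0r // mulr1.
rewrite (@sum_delta_all _ T (fun c j => [&& key c < key b, i == rev_ord c & j == rev_ord b])
  (fun c j => k * (tau c / tau b)) (rev_ord i) (rev_ord b)).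
  by rewrite rev_ordK !eqxx !andbT.
by move=> c j /and3P[_ /eqP -> /eqP ->]; rewrite rev_ordK.
Qed.

Lemma sum_Rhat_col e f :
  \sum_c \sum_d Rhat q qh d c e f *: T c d =
    ((if f == e then q else 1) * (if f == rev_ord e then q^-1 else 1)) *: T e f
    + (if key e < key f then k else 0) *: T f e
    - (if e == rev_ord f then k / tau f else 0) *:
        \sum_(d : 'I_N | key d < key f) tau d *: T (rev_ord d) d.
Proof.
rewrite (sum_Rhat_split _ (fun c d => RhatE d c e f)).
congr (_ + _ - _).
- rewrite (@sum_delta_all _ T (fun c d => (d == f) && (c == e))
    (fun c d => (if d == c then q else 1) * (if d == rev_ord c then q^-1 else 1)) e f) ?eqxx //.
  by move=> c d /andP[/eqP-> /eqP->].
- rewrite (@sum_delta_all _ T (fun c d => [&& key d < key c, d == e & c == f]) (fun _ _ => _) f e).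
    by rewrite !eqxx !andbT.
  by move=> c d /and3P[_ /eqP-> /eqP->].
rewrite exchange_big /= scaler_sumr [RHS]big_mkcond /=; apply: eq_bigr => d _.
rewrite (@sum_delta V _ predT (fun c => [&& key d < key f, c == rev_ord d & e == rev_ord f])
  (fun=> _) _ (rev_ord d)) => [|c /and3P[_ /eqP//]].
rewrite eqxx /=; case: (key d < key f); last by rewrite mulr0 scale0r.
case: (e == rev_ord f); rewrite ?mulr0 ?scale0r // mulr1 scalerA.
by rewrite -mulrA [_^-1 * _]mulrC.
Qed.
End Contractions2.
End BraidMatrix.

(** Conjugate factors sit symmetrically, so once the inner product is 1 the outermost pair becomes
    adjacent. For [N] odd the middle factor is its own conjugate; the first hypothesis makes only
    its square 1, hence the second one. *)
Lemma prod_nested (A : pzRingType) (N : nat) (f : 'I_N -> A) :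
  (forall i, f i * f (rev_ord i) = 1) ->
  (forall i, i = rev_ord i -> f i = 1) -> \prod_i f i = 1.
Proof.
have [n] := ubnP N; elim: n => // n IH in N f *.
case: N f => [|[|N]] f Nn ff f1; first by rewrite big_ord0.
  by rewrite big_ord1 f1 //; apply/val_inj.
rewrite big_ord_recl big_ord_recr /= IH; first 1 last.
- exact: ltnW.
- move=> i; rewrite -[RHS](ff (lift ord0 (widen_ord (leqnSn N) i))).
  by congr (_ * f _); apply/val_inj => /=; rewrite /bump /=; case: i => i /=; lia.
- by move=> i ii; apply: f1; apply/val_inj; move/(congr1 val): ii => /=; rewrite /bump /=; case: i => i /=; lia.
rewrite mul1r -[RHS](ff ord0); congr (_ * f _); apply/val_inj => /=.
by rewrite /bump /=; lia.
Qed.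

(** * The relations of $U_q^+so(N)$ from a pair of dual frames *)

Section Realization.
Variables (C : fieldType) (A : algType C) (N : nat) (qh : C).
Local Notation q := (qh ^+ 2).
Local Notation k := (q - q^-1).
Local Notation tau := (tau_ qh).
Hypotheses (N_gt0 : (0 < N)%N) (qh0 : qh != 0).
Variables (x lam D : 'I_N -> A) (c c' : nat -> A) (Lam : A).
Hypotheses (x_plane : qplane qh x c)
  (x_frame : forall h, qframe qh x c h (lam h) (D h))
  (lam_frame : forall h, qframe qh^-1 (fun i => lam (rev_ord i)) c' h
     (- x (rev_ord h)) (D (rev_ord h)))
  (lam_plane : qplane qh^-1 (fun i => lam (rev_ord i)) c').
Hypotheses (x_Lam : forall i, x i * Lam = q *: (Lam * x i))
  (lam_Lam : forall i, Lam * lam i = q *: (lam i * Lam))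
  (LamDD : forall i, Lam * Lam * (D i * D (rev_ord i)) = 1)
  (LamD : forall i, i = rev_ord i -> Lam * D i = 1).

Let q0 : q != 0. Proof. by rewrite expf_neq0. Qed.
Let qhV0 : qh^-1 != 0. Proof. by rewrite invr_eq0. Qed.

Definition comm_lam (a m : 'I_N) : A := lam a * x m - x m * lam a.
Local Notation E := comm_lam.

(** The metric has one nonzero entry per row, so in $g^{ih}\Lambda[\lambda_h,x^k]g_{kj}$ only
    $h=-i$, $k=-j$ remains. *)
Definition Lreal (i j : 'I_N) : A :=
  (tau i / tau j) *: (Lam * E (rev_ord i) (rev_ord j)).
Local Notation Lp := Lreal.

(** $x$ and $\lambda$ pass $\Lambda$ with inverse powers of $q$. *)
Lemma comm_lam_Lam a m : E a m * Lam = Lam * E a m.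
Proof.
rewrite /E mulrBl mulrBr !mulrA lam_Lam -[lam a * _ * _]mulrA x_Lam.
rewrite -[x m * _ * _]mulrA -[Lam * _ * _]mulrA -scalerAr -scalerAl !mulrA; congr (_ - _).
have -> : Lam * x m = q^-1 *: (x m * Lam).
  by rewrite x_Lam scalerA mulVf // scale1r.
by rewrite -scalerAl -[x m * Lam * _]mulrA lam_Lam -scalerAr scalerA mulVf // scale1r !mulrA.
Qed.

Lemma Lreal_Lam i j : Lam * Lp i j = Lp i j * Lam.
Proof.
rewrite /Lp -scalerAl -scalerAr.
by rewrite -[Lam * _ * Lam]mulrA comm_lam_Lam.
Qed.

Lemma Lreal_tri i j : idx j < idx i -> Lp i j = 0.
Proof.
rewrite idx_lt => ji; rewrite /Lp /E (frame_comm_ge (x_frame _)).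
- by rewrite mulr0 scaler0.
- by rewrite !key_rev /key; lia.
- by rewrite (inj_eq rev_ord_inj); apply: contraTneq ji => ->; rewrite ltnn.
Qed.

Lemma Lreal_diag i : Lp i i = Lam * D (rev_ord i).
Proof. by rewrite /Lp /E (fr_comm (x_frame _)) divff ?tau_neq0 // scale1r. Qed.

Lemma Lam_D i : Lam * D i = D i * Lam.
Proof. by have := comm_lam_Lam i i; rewrite /E (fr_comm (x_frame i)). Qed.

Lemma Lreal_det : \prod_i Lp i i = 1.
Proof.
apply: prod_nested => i => [|ii]; rewrite !Lreal_diag.
  rewrite -[RHS](LamDD (rev_ord i)) rev_ordK !mulrA.
  rewrite -[Lam * D _ * Lam]mulrA -Lam_D !mulrA.
  by rewrite -[Lam * Lam * _ * _]mulrA.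
by apply: LamD; rewrite rev_ordK.
Qed.

Lemma sum_metric (V : lmodType C) (T : 'I_N -> 'I_N -> V) :
  \sum_j \sum_k0 metric qh k0 j *: T j k0 =
  \sum_j (tau j)^-1 *: T j (rev_ord j).
Proof.
apply: eq_bigr => j _; rewrite (bigD1 (rev_ord j)) //= big1 ?addr0 => [|i ij].
  by rewrite /metric eqxx qrho_tau // tau_rev.
by rewrite /metric (negbTE ij) scale0r.
Qed.

Lemma Lreal_metric_up i h :
  \sum_j \sum_k0 metric qh k0 j *: (Lp i j * Lp h k0) = metric qh h i *: 1.
Proof.
rewrite sum_metric (reindex_inj rev_ord_inj) /=.
transitivity ((tau i * tau h) *: (Lam * Lam * \sum_m tau m *:
    (E (rev_ord i) m * E (rev_ord h) (rev_ord m)))).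
  rewrite mulr_sumr scaler_sumr; apply: eq_bigr => m _.
  rewrite /Lp !rev_ordK -!(scalerAl, scalerAr) !scalerA -!mulrA [E _ _ * (Lam * _)]mulrA.
  rewrite comm_lam_Lam !mulrA; congr (_ *: _); rewrite tau_rev //.
  have t0 := tau_neq0 m qh0.
  by rewrite !invrK; field.
rewrite /comm_lam (frame_metric N_gt0 qh0 x_plane (x_frame _) (x_frame _)) /metric !rev_ordK.
rewrite -(inj_eq rev_ord_inj) rev_ordK eq_sym.
have [<-|_] := eqVneq; last by rewrite mulr0 scaler0 scale0r.
rewrite -scalerAr scalerA -[_ * _ * tau _]mulrA tau_rev // mulVKf ?tau_neq0 //.
by rewrite LamDD qrho_tau // tau_rev.
Qed.

(** The summed index now belongs to the momenta, so [frame_metric] is applied to the dual frame,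
    where the $\lambda$ are the coordinates and the $-x$ the momenta. *)
Lemma Lreal_metric_lo i h :
  \sum_j \sum_k0 metric qh k0 j *: (Lp j i * Lp k0 h) = metric qh h i *: 1.
Proof.
rewrite sum_metric.
transitivity ((tau i * tau h)^-1 *: (Lam * Lam * \sum_m tau_ qh^-1 m *:
    (E (rev_ord m) (rev_ord i) * E m (rev_ord h)))).
  rewrite mulr_sumr scaler_sumr; apply: eq_bigr => m _.
  rewrite /Lp !rev_ordK -!(scalerAl, scalerAr) !scalerA -!mulrA [E _ _ * (Lam * _)]mulrA.
  rewrite comm_lam_Lam !mulrA; congr (_ *: _); rewrite tau_rev // tau_inv.
  have t0 := tau_neq0 m qh0; have ti := tau_neq0 i qh0; have th := tau_neq0 h qh0.
  by field; rewrite t0 ti th.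
have := frame_metric N_gt0 qhV0 lam_plane (lam_frame i) (lam_frame h).
rewrite (eq_bigr (fun m => tau_ qh^-1 m *:
  (E (rev_ord m) (rev_ord i) * E m (rev_ord h)))) => [->|m _]; last first.
  by rewrite /comm_lam rev_ordK !mulrN !mulNr !opprK ![- _ + _]addrC.
rewrite /metric eq_sym -(inj_eq rev_ord_inj) rev_ordK eq_sym.
have [<-|_] := eqVneq; last by rewrite mulr0 scaler0 scale0r.
rewrite -scalerAr scalerA rev_ordK LamDD tau_inv qrho_tau // tau_rev //.
by rewrite mulVf ?tau_neq0 // invr1 mul1r invrK.
Qed.

Lemma x_Lreal i a b :
  x i * Lp a b = \sum_j \sum_m Rhat q qh j i m b *: (Lp a j * x m).
Proof.
rewrite (sum_Rhat_mid qh0 (fun j m => Lp a j * x m)).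
have := frame_cross N_gt0 qh0 x_plane (x_frame (rev_ord a)) i (rev_ord b).
rewrite rev_ordK -!/(comm_lam _ _) => H.
have -> : x i * Lp a b = (tau a / tau b) *: (Lam * (q *: (x i * E (rev_ord a) (rev_ord b)))).
  by rewrite /Lp -!scalerAr [x i * (Lam * _)]mulrA x_Lam -!scalerAl mulrA.
have e1 : (b == rev_ord i) = (i == rev_ord b).
  by rewrite eq_sym -(inj_eq rev_ord_inj) rev_ordK.
rewrite H e1 [b == i]eq_sym.
rewrite addrAC 2!mulrDr 2!scalerDr mulrN scalerN.
congr (_ + _ - _).
- by rewrite /Lp -!(scalerAl, scalerAr) !mulrA !scalerA mulrC.
- case: eqP => [<-|_]; last by rewrite !scale0r mulr0 scaler0.
  rewrite -scalerAr scalerA mulr_sumr !scaler_sumr (reindex_inj rev_ord_inj) /=.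
  apply: eq_big => [d|d _]; first by rewrite !key_rev ltrN2.
  rewrite /comm_lam -/(comm_lam _ _) rev_ordK /Lp -!(scalerAl, scalerAr) !scalerA !mulrA.
  congr (_ *: _); rewrite !tau_rev // invrK.
  have ti := tau_neq0 i qh0; have td := tau_neq0 d qh0.
  by move: (tau a) => t; field; rewrite ?ti ?td ?qh0.
rewrite !key_rev ltrNl; case: ifP => _; last by rewrite !scale0r mulr0 scaler0.
rewrite /Lp rev_ordK -!(scalerAl, scalerAr) !scalerA !mulrA; congr (_ *: _).
rewrite !tau_rev // invrK.
have ti := tau_neq0 i qh0; have tb := tau_neq0 b qh0.
by move: (tau a) => t; field; rewrite ?ti ?tb ?qh0.
Qed.

(** This is [frame_cross] in the opposite algebra at $q^{-1}$; it carries a bracket to the right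
    across a coordinate. *)
Lemma Lreal_x m i h :
  q^-1 *: (E h m * x i) =
    ((if i == rev_ord m then q^-1 else 1) * (if i == m then q else 1))
       *: (x i * E h m)
    + (if key m < key i then k else 0) *: (x m * E h i)
    - (if i == rev_ord m then k * tau m else 0) *:
        \sum_(d : 'I_N | key m < key d) (tau d)^-1 *: (x (rev_ord d) * E h d).
Proof.
(* Written with the products of [A]; the reversed products of the opposite algebra unfold to these
   by conversion. *)
have H : qh^-1 ^+ 2 *: ((x m * - lam h - - lam h * x m) * x i) =
    ((if i == rev_ord m then qh^-1 ^+ 2 else 1)
      * (if i == m then (qh^-1 ^+ 2)^-1 else 1))
      *: (x i * (x m * - lam h - - lam h * x m))
    - (if key m < key i then qh^-1 ^+ 2 - (qh^-1 ^+ 2)^-1 else 0)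
      *: (x m * (x i * - lam h - - lam h * x i))
    + (if i == rev_ord m then (qh^-1 ^+ 2 - (qh^-1 ^+ 2)^-1) * (tau_ qh^-1 m)^-1
       else 0)
      *: \sum_(d : 'I_N | key m < key d) tau_ qh^-1 d
           *: (x (rev_ord d) * (x d * - lam h - - lam h * x d)).
  exact: (@frame_cross C (GRing.converse A) N qh^-1 N_gt0 qhV0 x c
    (qplane_converse qh0 x_plane) h (- lam h) (D h)
    (qframe_converse qh0 (x_frame h)) i m).
have EE a : x a * - lam h - - lam h * x a = E h a.
  by rewrite mulrN mulNr opprK addrC.
rewrite !EE in H; move: H; rewrite !tau_inv !exprVn !invrK => ->.
congr (_ + _ + _); first by rewrite -scaleNr; case: ifP; rewrite ?opprB ?oppr0.
rewrite -scaleNr; congr (_ *: _); first by case: ifP => _; rewrite ?oppr0 // -[RHS]mulNr opprB.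
by apply: eq_bigr => d _; rewrite EE tau_inv.
Qed.

(** This is [frame_cross] for the dual frame; it carries a bracket to the left across a momentum. *)
Lemma lam_Lreal m i h :
  q^-1 *: (lam (rev_ord i) * E (rev_ord m) h) =
    ((if i == rev_ord m then q^-1 else 1) * (if i == m then q else 1))
       *: (E (rev_ord m) h * lam (rev_ord i))
    + (if key m < key i then k else 0) *: (E (rev_ord i) h * lam (rev_ord m))
    - (if i == rev_ord m then k * tau m else 0) *:
        \sum_(d : 'I_N | key m < key d) (tau d)^-1 *: (E (rev_ord d) h * lam d).
Proof.
have := frame_cross N_gt0 qhV0 lam_plane (lam_frame (rev_ord h)) i m.
have EE a : - x (rev_ord (rev_ord h)) * lam (rev_ord a)
    - lam (rev_ord a) * - x (rev_ord (rev_ord h)) = E (rev_ord a) h.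
  by rewrite rev_ordK mulrN mulNr opprK addrC.
rewrite !EE !tau_inv !exprVn !invrK => ->.
congr (_ + _ + _); first by rewrite -scaleNr; case: ifP; rewrite ?opprB ?oppr0.
rewrite -scaleNr; congr (_ *: _); first by case: ifP => _; rewrite ?oppr0 // -[RHS]mulNr opprB.
by apply: eq_bigr => d _; rewrite EE tau_inv rev_ordK.
Qed.

(** One of the two factors is written as $\Lambda(\lambda x-x\lambda)$, with the metric factors put
    into [ll] and [xl]. The other factor passes [ll] by means of the braid matrix with upper indices
    $a,b$, and [xl] by means of the one with lower indices $e,f$. The two matrices act on different
    indices, so both orders of passage give the same coefficients. *)
Lemma Lreal_RLL a b e f :
  \sum_s \sum_t Rhat q qh a b s t *: (Lp t f * Lp s e) =
  \sum_s \sum_t Rhat q qh t s e f *: (Lp b s * Lp a t).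
Proof.
pose xl j := (tau j)^-1 *: x (rev_ord j).
pose ll j := tau j *: lam (rev_ord j).
have LE i j : Lp i j = Lam * (ll i * xl j - xl j * ll i).
  rewrite /Lp /E /ll /xl -!(scalerAl, scalerAr) !scalerA [(tau j)^-1 * _]mulrC.
  by rewrite -scalerBr -scalerAr.
have xL i : Lp i f * xl e = \sum_s \sum_t Rhat q qh t s e f *: (xl s * Lp i t).
  rewrite (sum_Rhat_col qh0 (fun s t => xl s * Lp i t)).
  have H := Lreal_x (rev_ord f) (rev_ord e) (rev_ord i).
  have t0 (j : 'I_N) := tau_neq0 j qh0.
  have -> : Lp i f * xl e = (tau i / tau f / tau e) *:
      (Lam * (E (rev_ord i) (rev_ord f) * x (rev_ord e))).
    by rewrite /Lp /xl -scalerAl -scalerAr scalerA !mulrA.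
  have -> : E (rev_ord i) (rev_ord f) * x (rev_ord e) =
      q *: (q^-1 *: (E (rev_ord i) (rev_ord f) * x (rev_ord e))).
    by rewrite scalerA mulfV // scale1r.
  have LT s t : xl s * Lp i t = (q * (tau i / tau t / tau s)) *:
      (Lam * (x (rev_ord s) * E (rev_ord i) (rev_ord t))).
    rewrite /Lp /xl -!(scalerAl, scalerAr) scalerA.
    rewrite [x _ * (Lam * _)]mulrA x_Lam -scalerAl scalerA [Lam * (_ * _)]mulrA.
    by congr (_ *: _); ring.
  rewrite {}H !LT rev_ordK !(inj_eq rev_ord_inj).
  have e1 : (rev_ord e == f) = (f == rev_ord e) by rewrite eq_sym.
  have e2 : (e == rev_ord f) = (f == rev_ord e).
    by rewrite eq_sym -(inj_eq rev_ord_inj) rev_ordK.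
  rewrite e1 e2 [e == f]eq_sym !key_rev ltrN2.
  rewrite scalerBr scalerDr mulrBr mulrDr scalerBr scalerDr.
  congr (_ + _ - _).
  - rewrite -!scalerAr !scalerA; congr (_ *: _).
    rewrite ![_ * (if f == e then _ else _)]mulrC.
    by move: (tau i) (tau f) (tau e) => ti tf te; do 2!case: ifP => _; ring.
  - rewrite -!scalerAr !scalerA; congr (_ *: _).
    by move: (tau i) (tau f) (tau e) => ti tf te; case: ifP => _; ring.
  case: eqP => [fe|_]; last by rewrite !scale0r scaler0 mulr0 scaler0.
  rewrite -!scalerAr scalerA mulr_sumr !scaler_sumr (reindex_inj rev_ord_inj) /=.
  apply: eq_big => [d|d _]; first by rewrite !key_rev ltrN2.
  rewrite LT rev_ordK -!(scalerAl, scalerAr) !scalerA; congr (_ *: _).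
  rewrite !tau_rev // fe tau_rev //.
  have := t0 d; have := t0 e; move: (tau i) (tau d) (tau e) => ti td te te0 td0.
  by rewrite !invrK; field; rewrite te0 td0 qh0.
have lL i : \sum_s \sum_t Rhat q qh a b s t *: (Lp t i * ll s) = ll b * Lp a i.
  rewrite (sum_Rhat_row qh0 (fun s t => Lp t i * ll s)).
  have H := lam_Lreal a b (rev_ord i).
  have t0 (j : 'I_N) := tau_neq0 j qh0.
  have LT s t : Lp t i * ll s = (tau t / tau i * tau s) *:
      (Lam * (E (rev_ord t) (rev_ord i) * lam (rev_ord s))).
    by rewrite /Lp /ll -scalerAl -scalerAr scalerA !mulrA.
  have -> : ll b * Lp a i = (tau b * (tau a / tau i)) *:
      (Lam * (q^-1 *: (lam (rev_ord b) * E (rev_ord a) (rev_ord i)))).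
    rewrite /Lp /ll -!(scalerAl, scalerAr) scalerA mulrA.
    congr (_ *: _); rewrite [Lam * (lam _ * _)]mulrA lam_Lam -!scalerAl scalerA.
    by rewrite mulVf // scale1r mulrA.
  rewrite {}H !LT.
  have e2 : (a == rev_ord b) = (b == rev_ord a).
    by rewrite eq_sym -(inj_eq rev_ord_inj) rev_ordK.
  rewrite e2 [a == b]eq_sym mulrBr mulrDr scalerBr scalerDr.
  congr (_ + _ - _).
  - rewrite -!scalerAr !scalerA; congr (_ *: _).
    by move: (tau i) (tau a) (tau b) => ti ta tb; do 2!case: ifP => _; ring.
  - rewrite -!scalerAr !scalerA; congr (_ *: _).
    by move: (tau i) (tau a) (tau b) => ti ta tb; case: ifP => _; ring.
  case: eqP => [ba|_]; last by rewrite !scale0r mulr0 scaler0.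
  rewrite -!scalerAr scalerA mulr_sumr !scaler_sumr; apply: eq_bigr => d _.
  rewrite LT rev_ordK -!(scalerAl, scalerAr) !scalerA; congr (_ *: _).
  rewrite !tau_rev // ba tau_rev //.
  have := t0 d; have := t0 a; have := t0 i.
  move: (tau i) (tau d) (tau a) => ti td ta ti0 ta0 td0.
  by field; rewrite ti0 ta0 td0 qh0.
transitivity (\sum_s \sum_t Rhat q qh a b s t *:
    (Lam * (Lp t f * ll s * xl e - Lp t f * xl e * ll s))).
  apply: eq_bigr => s _; apply: eq_bigr => t _; congr (_ *: _).
  by rewrite [Lp s e]LE mulrA -Lreal_Lam -mulrA mulrBr !mulrA.
transitivity (Lam * (ll b * (Lp a f * xl e) -
    \sum_s \sum_t Rhat q qh a b s t *: (Lp t f * xl e * ll s))).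
  rewrite mulrA -lL mulr_suml -sumrB mulr_sumr; apply: eq_bigr => s _.
  rewrite mulr_suml -sumrB mulr_sumr; apply: eq_bigr => t _.
  by rewrite [LHS]scalerAr scalerBr; congr (_ * (_ - _)); rewrite scalerAl.
(* In the first term the passage across [ll] has been made and the one across [xl] follows; in the
   second term [xl] is passed first and [ll] afterwards. *)
transitivity (Lam * (ll b * (\sum_s \sum_t Rhat q qh t s e f *: (xl s * Lp a t))
   - \sum_s \sum_t Rhat q qh t s e f *: (xl s * (ll b * Lp a t)))).
  congr (_ * (_ - _)); first by rewrite xL.
  rewrite !pair_bigA /=.
  under [RHS]eq_bigr => p' _ do rewrite -lL pair_bigA mulr_sumr scaler_sumr.
  rewrite exchange_big /=; apply: eq_bigr => p _.
  rewrite xL pair_bigA mulr_suml scaler_sumr; apply: eq_bigr => p' _ /=.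
  move: (Rhat _ _ _ _ _ _) (Rhat _ _ _ _ _ _) (xl _) (Lp _ _) (ll _) => r r' u v w.
  by rewrite -scalerAl -scalerAr !scalerA mulrC mulrA.
rewrite mulr_sumr -sumrB mulr_sumr; apply: eq_bigr => s _.
rewrite mulr_sumr -sumrB mulr_sumr; apply: eq_bigr => t _.
rewrite -[ll b * (_ *: _)]scalerAr -scalerBr -[Lam * (_ *: _)]scalerAr; congr (_ *: _).
by rewrite [Lp b s]LE; move: (Lp a t) (ll b) (xl s) => u v w; rewrite -mulrA mulrBl !mulrA.
Qed.
End Realization.

(** * Commutation up to a power of $q$ *)

Section QCommutation.
Variables (C : fieldType) (A : algType C) (q : C).
Hypothesis (q0 : q != 0).

Definition qcomm (a b : A) (z : int) : Prop := a * b = q ^ z *: (b * a).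

Lemma qcomm_eq a b z z' : qcomm a b z -> z = z' -> qcomm a b z'.
Proof. by move=> ? <-. Qed.

Lemma qcomm_sym a b z : qcomm a b z -> qcomm b a (- z).
Proof.
by rewrite /qcomm => ->; rewrite scalerA -expfzDr // addNr expr0z scale1r.
Qed.

Lemma qcommMl a a' b z z' : qcomm a b z -> qcomm a' b z' -> qcomm (a * a') b (z + z').
Proof.
rewrite /qcomm => H H'; rewrite -mulrA H' -scalerAr [a * (b * _)]mulrA H -scalerAl.
by rewrite scalerA -expfzDr // [z' + z]addrC mulrA.
Qed.

Lemma qcommMr a b b' z z' : qcomm a b z -> qcomm a b' z' -> qcomm a (b * b') (z + z').
Proof.
rewrite /qcomm => H H'; rewrite mulrA H -scalerAl -[b * a * _]mulrA H' -scalerAr scalerA.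
by rewrite -expfzDr // mulrA.
Qed.

Lemma qcommZl s a b z : qcomm a b z -> qcomm (s *: a) b z.
Proof. by rewrite /qcomm -scalerAl -scalerAr => ->; rewrite !scalerA mulrC. Qed.

Lemma qcommZr s a b z : qcomm a b z -> qcomm a (s *: b) z.
Proof. by rewrite /qcomm -scalerAl -scalerAr => ->; rewrite !scalerA mulrC. Qed.

Lemma qcomm_inv a a' b z : a * a' = 1 -> a' * a = 1 -> qcomm a b z -> qcomm a' b (- z).
Proof.
rewrite /qcomm => aa' a'a ab.
have: a' * (a * b) * a' = q ^ z *: (a' * (b * a) * a').
  by rewrite ab -scalerAr -scalerAl.
rewrite !mulrA a'a mul1r -!mulrA aa' mulr1 => ->.
by rewrite scalerA -expfzDr // addNr expr0z scale1r.
Qed.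

Lemma qcomm0 a b : qcomm a b 0 <-> a * b = b * a.
Proof. by rewrite /qcomm expr0z scale1r. Qed.
End QCommutation.

Lemma expfz_n2 (C : fieldType) (z : C) : z ^ (- 2) = z ^- 2.
Proof. by []. Qed.

(** The exponent $e$ in $r_jx^i=q^ex^ir_j$, with $z$ the key of $i$ and the radii counted by keys as
    well. *)
Definition rexp (j : nat) (z : int) : int := (j%:Z < z)%R%:Z - (z < - j%:Z)%R%:Z.
(** The exponent of $\Lambda^{-1}r_{|h|}^{-1}r_{|h|-1}^{-1}$ against $x^i$, with radii counted by
    keys. The last summand comes from $K^{\pm1}$, present at key 0 for [N] even; for [N] odd it is
    0, as there [h] equals [rev_ord h]. *)
Definition uexp (N : nat) (h i : 'I_N) : int :=
  1 - rexp `|key h|%N (key i) - rexp `|key h|%N.-1 (key i)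
  + (key h == 0)%:Z * ((i == h)%:Z - (i == rev_ord h)%:Z).

(** * Dual frames from a factorisation $\lambda_h=u_hx^{-h}$ *)

Section Momenta.
Variables (C : fieldType) (A : algType C) (N : nat) (qh : C).
Local Notation q := (qh ^+ 2).
Local Notation k := (q - q^-1).
Local Notation eta := (eta_ N qh).
Hypotheses (N_gt0 : (0 < N)%N) (qh0 : qh != 0) (k0 : k != 0).
Variables (x u : 'I_N -> A) (c c' : nat -> A).
Local Notation qc := (qcomm q).
Hypotheses (x_plane : qplane qh x c)
  (c_x : forall j i, (j <= N.-1./2)%N -> qc (c j) (x i) (2 * rexp j (key i)))
  (u_x : forall h i, qc (u h) (x i) (uexp h i))
  (u_c : forall h j, (j <= N.-1./2)%N -> qc (u h) (c j) 2)
  (u_u : forall h i, u h * u i = u i * u h)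
  (u_u_c : forall h, u h * u (rev_ord h) * c (frame_index (- key h)) =
     (if key h == 0 then q * (if odd N then 1 else q) else - q)
       *: c' (frame_index (key h))).

(** The factor [u h] commutes with coordinates and radii up to powers of $q$, so the relations of
    the momenta follow from those of the coordinates by counting exponents. *)
Definition momentum (h : 'I_N) : A := u h * x (rev_ord h).
(** Moving [u h] to the left in the bracket leaves $x^{-h}x^h-q^{-e}x^hx^{-h}$ with $e$ equal to
    [uexp h h]; by [qplane] this is a multiple of one radius, and [Dcoef] is the factor. *)
Definition Dcoef (z : int) : C :=
  if 0 < z then - k else q^-1 * k * (if z < 0 then 1 else eta).
Definition Dmom (h : 'I_N) : A :=
  Dcoef (key h) *: (u h * c (frame_index (key h))).
Local Notation lam := momentum.
Local Notation D := Dmom.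

Let q0 : q != 0. Proof. by rewrite expf_neq0. Qed.

Lemma frame_index_le (i : 'I_N) : (frame_index (key i) <= N.-1./2)%N.
Proof. by have := key_le i; rewrite /frame_index; case: ifP => _; lia. Qed.
Lemma frame_index_leN (i : 'I_N) : (frame_index (- key i) <= N.-1./2)%N.
Proof. by rewrite -key_rev frame_index_le. Qed.

Lemma x_x i j : i != rev_ord j ->
  qc (x i) (x j) ((key i < key j)%R%:Z - (key j < key i)%R%:Z).
Proof.
move=> ij; case: (ltrgtP (key i) (key j)) => [lt|gt|e].
- by rewrite /qcomm (qp_lt x_plane lt ij) expr1z.
- apply: qcomm_eq; first apply: (qcomm_sym q0 (z := 1)); last by [].
  rewrite /qcomm expr1z (qp_lt x_plane gt) //.
  by apply: contraNneq ij => ->; rewrite rev_ordK.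
- case: (key_eq e) => [->|[ji]]; first exact/qcomm0.
  by rewrite ji rev_ordK eqxx in ij.
Qed.

Lemma key_neq (i h : 'I_N) : i != h -> i != rev_ord h ->
  key i != key h /\ key i != - key h.
Proof.
move=> ih ir; rewrite -key_rev; split; apply/eqP => /key_eq[e|[e _ _]].
- by rewrite e eqxx in ih.
- by rewrite e rev_ordK eqxx in ir.
- by rewrite e eqxx in ir.
- by rewrite -(inj_eq rev_ord_inj) -e eqxx in ih.
Qed.

(** For a nonzero key the radial part of the product is a quotient of two consecutive radii, whose
    exponents differ only at $x^{\pm h}$. At key 0 the radii cancel and $K^{\pm1}$ is responsible
    for the difference. *)
Lemma u_c_x h i : qc (u h * c (frame_index (key h))) (x i)
  (1 + (i == h)%:Z - (i == rev_ord h)%:Z).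
Proof.
apply: qcomm_eq.
  by apply: (qcommMl q0 (u_x h i) (c_x i (frame_index_le h))).
have kh := key_rev h; rewrite /uexp /frame_index /rexp.
have [->|ih] := eqVneq i h.
  by rewrite rev_fix; case: (ltrP 0 (key h)) => ?; case: (odd N); lia.
have [->|ir] := eqVneq i (rev_ord h).
  by rewrite kh; case: (ltrP 0 (key h)) => ?; lia.
have [k1 k2] := key_neq ih ir.
by case: (ltrP 0 (key h)) => ?; lia.
Qed.

Lemma D_x h i : qc (D h) (x i) (1 + (i == h)%:Z - (i == rev_ord h)%:Z).
Proof. exact/qcommZl/u_c_x. Qed.

Lemma lam_x h i : i != h ->
  qc (lam h) (x i) (if key i < key h then 2 else 0).
Proof.
move=> ih; apply: qcomm_eq.
  apply: (qcommMl q0 (u_x h i) (@x_x (rev_ord h) i _)).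
  by rewrite (inj_eq rev_ord_inj) eq_sym.
have kh := key_rev h; rewrite /uexp /rexp kh (negbTE ih).
have [->|ir] := eqVneq i (rev_ord h).
  by rewrite kh; case: (ltrP (- key h) (key h)) => ?; lia.
have [k1 k2] := key_neq ih ir.
by case: (ltrP (key i) (key h)) => ?; lia.
Qed.

Lemma uexp_diag (h : 'I_N) : uexp h h =
  if 0 < key h then 0 else if key h < 0 then 2 else if odd N then 1 else 2.
Proof.
rewrite /uexp /rexp eqxx rev_fix.
by case: (ltrgtP 0 (key h)) => ?; case: (odd N); lia.
Qed.

Lemma uexp_rev (h : 'I_N) : uexp h (rev_ord h) =
  if 0 < key h then 2 else if key h < 0 then 0 else if odd N then 1 else 0.
Proof.
rewrite /uexp /rexp eqxx [rev_ord h == h]eq_sym rev_fix key_rev.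
by case: (ltrgtP 0 (key h)) => ?; case: (odd N); lia.
Qed.

Lemma lam_comm h : lam h * x h - x h * lam h = D h.
Proof.
have e : u h * x h = q ^ uexp h h *: (x h * u h) := u_x h h.
have -> : x h * lam h = q ^ (- uexp h h) *: (u h * (x h * x (rev_ord h))).
  by rewrite /momentum !mulrA e -scalerAl scalerA -expfzDr // addNr expr0z scale1r.
rewrite /Dmom /momentum -mulrA !(scalerAr _ (u h)) -mulrBr; congr (_ * _).
rewrite /frame_index /Dcoef uexp_diag.
case: (ltrgtP 0 (key h)) => [h0|h0|h0].
- rewrite expr0z scale1r (qp_neg x_plane h0) (qp_pos x_plane h0).
  by rewrite opprB addrC addrA subrK -scalerBl -opprB scaleNr.
- have r0 : 0 < key (rev_ord h) by rewrite key_rev; lia.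
  have := qp_neg x_plane r0; have := qp_pos x_plane r0; rewrite rev_ordK => -> ->.
  rewrite key_rev abszN scalerBr scalerA.
  have -> : q ^ (- 2) * q = q^-1 by rewrite expfz_n2; field.
  rewrite opprB addrA subrK.
  by rewrite -{1}[c _]scale1r -scalerBl mulr1; congr (_ *: _); rewrite expfz_n2; field.
have r0 : key (rev_ord h) = 0 by rewrite key_rev -h0.
have := qp_zero x_plane r0; rewrite (qp_zero x_plane (esym h0)) rev_ordK => ->.
rewrite scalerA -scalerBl -h0 /eta_; congr (_ *: _).
case: ifP => _; rewrite ?expfz_n2 ?exprN1; by field.
Qed.

Lemma D_xrev h : D h * x (rev_ord h) =
  - ((1 - q ^- 2) * frame_coef N qh (key h))
    *: (lam h * c (frame_index (key h))).
Proof.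
rewrite /Dmom -!(scalerAl, scalerAr) -mulrA (c_x (rev_ord h) (frame_index_le h)).
rewrite -scalerAr scalerA /momentum -mulrA; congr (_ *: _).
rewrite /rexp key_rev /frame_index /Dcoef /frame_coef.
case: (ltrgtP 0 (key h)) => h0.
- have -> : 2 * ((`|key h|%N.-1%:Z < - key h)%R%:Z - (- key h < - `|key h|%N.-1%:Z)%R%:Z) = -2 :> int by lia.
  by rewrite expfz_n2; field.
- have -> : 2 * ((`|key h|%N%:Z < - key h)%R%:Z - (- key h < - `|key h|%N%:Z)%R%:Z) = 0 :> int by lia.
  by rewrite expr0z; field.
- by rewrite -h0 /= expr0z; field.
Qed.

Lemma c_lam h j : (j <= N.-1./2)%N ->
  qc (c j) (lam h) (- 2 + 2 * rexp j (- key h)).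
Proof.
move=> jN; have := c_x (rev_ord h) jN; rewrite key_rev.
exact: qcommMr (qcomm_sym q0 (u_c h jN)).
Qed.

Lemma x_frame h : qframe qh x c h (lam h) (D h).
Proof.
split=> [i ih|i hi ih||i||].
- have := @lam_x h i; rewrite ih => H; apply: H.
  by apply: contraTneq ih => ->; rewrite ltxx.
- by have := lam_x ih; rewrite ltNge hi => /qcomm0.
- exact: lam_comm.
- rewrite (D_x h i); congr (_ *: _).
  by case: eqP => _; case: eqP => _; rewrite ?mulr1 // -?expfzDr // ?expr1z //; try field.
- exact: D_xrev.
rewrite (qcomm_sym q0 (D_x h (rev_ord h))) D_xrev eqxx.
rewrite (c_lam h (frame_index_le h)) !scalerA; congr (_ *: _).
rewrite [rev_ord h == h]eq_sym rev_fix /rexp /frame_index /frame_coef.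
case: (ltrgtP 0 (key h)) => h0.
- rewrite andbF.
  have -> : -2 + 2 * ((`|key h|%N.-1%:Z < - key h)%R%:Z - (- key h < - `|key h|%N.-1%:Z)%R%:Z) = -4 :> int by lia.
  by rewrite -[q ^ (-4)%Z]/(q ^- 4) -[q ^ (- _)]/(1 : C) exprVn invrK; field.
- rewrite andbF.
  have -> : -2 + 2 * ((`|key h|%N%:Z < - key h)%R%:Z - (- key h < - `|key h|%N%:Z)%R%:Z) = -2 :> int by lia.
  by rewrite expfz_n2 -[q ^ (- (1 + _ - _))]/(1 : C); field.
rewrite -h0 /= andbT eta_inv /eta_ -[q ^ (-2 + _)]/(q ^- 2).
case: (odd N); last by rewrite -[q ^ (- (1 + _ - _))]/(1 : C) invr1; field.
by rewrite -[q ^ (- (1 + _ - _))]/(q^-1); field.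
Qed.

Lemma D_lam a b :
  qc (D a) (lam b) (- 1 + (b == rev_ord a)%:Z - (b == a)%:Z).
Proof.
have H1 : qc (D a) (u b) (- 2).
  apply/qcommZl/(qcomm_eq (z := 0 + - 2)); last by [].
  apply: qcommMl => //; first exact/qcomm0.
  exact/qcomm_sym/u_c/frame_index_le.
apply: qcomm_eq; first exact: (qcommMr q0 H1 (D_x a (rev_ord b))).
by rewrite (inj_eq rev_ord_inj) -[_ == a](inj_eq rev_ord_inj) rev_ordK; lia.
Qed.

Lemma u_u_c' h : u h * u (rev_ord h) * c (frame_index (key h)) =
     (if key h == 0 then q * (if odd N then 1 else q) else - q)
       *: c' (frame_index (- key h)).
Proof.
by rewrite u_u -{2}[h]rev_ordK -[key h in LHS]opprK -key_rev u_u_c key_rev oppr_eq0.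
Qed.

Lemma lam_D h : lam h * D (rev_ord h) =
  - ((1 - q ^- 2) * frame_coef N qh (key h))
    *: (c' (frame_index (key h)) * x (rev_ord h)).
Proof.
have H := D_x (rev_ord h) (rev_ord h).
rewrite /momentum -mulrA (qcomm_sym q0 H) eqxx.
rewrite /Dmom -!scalerAl -!scalerAr !mulrA key_rev u_u_c -!scalerAl !scalerA.
congr (_ *: _); rewrite rev_ordK [rev_ord h == h]eq_sym rev_fix /Dcoef /frame_coef.
rewrite oppr_gt0 oppr_lt0; case: (ltrgtP 0 (key h)) => h0.
- by rewrite andbF -[q ^ _]/(q ^- 2); field.
- by rewrite andbF -[q ^ _]/(q ^- 2); field.
- rewrite andbT /eta_; case: (odd N).
    by rewrite -[q ^ _]/(q^-1); field.
  by rewrite -[q ^ _]/(q ^- 2); field.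
Qed.

(** The commutation of [c'] is inferred from [u_u_c], which writes it, up to a nonzero scalar, as a
    product of two factors [u] and a radius. *)
Lemma c'_x h : qc (c' (frame_index (key h))) (x (rev_ord h))
  (2 - (h == rev_ord h)%:Z + uexp h (rev_ord h)).
Proof.
have s0 : (if key h == 0 then q * (if odd N then 1 else q) else - q) != 0.
  by case: ifP => _; rewrite ?oppr_eq0 ?mulf_neq0 //; case: ifP => _; rewrite ?oner_neq0.
rewrite -[c' _]scale1r -(mulVf s0) -scalerA -u_u_c; apply/qcommZl.
rewrite -mulrA -key_rev; apply: qcomm_eq.
  exact: (qcommMl q0 (u_x h (rev_ord h)) (u_c_x (rev_ord h) (rev_ord h))).
by rewrite eqxx rev_ordK [rev_ord h == h]eq_sym; lia.
Qed.

Lemma lam_lam i j : i != j -> i != rev_ord j ->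
  qc (lam i) (lam j) ((key i < key j)%R%:Z - (key j < key i)%R%:Z).
Proof.
move=> ij ir.
have H1 : qc (lam i) (u j) (- uexp j (rev_ord i)).
  rewrite -[- _]add0r; apply: qcommMl (qcomm_sym q0 (u_x _ _)) => //.
  exact/qcomm0.
have H2 := @lam_x i (rev_ord j); rewrite eq_sym in H2.
apply: qcomm_eq; first exact: (qcommMr q0 H1 (H2 ir)).
have [k1 k2] := key_neq ij ir.
rewrite /uexp /rexp !key_rev (inj_eq rev_ord_inj).
rewrite (negbTE ij) -[_ == j](inj_eq rev_ord_inj) rev_ordK (negbTE ir).
by case: (ltrP (- key j) (key i)) => ?; lia.
Qed.

Lemma lam_prod i : lam i * lam (rev_ord i) =
  q ^ (- uexp (rev_ord i) (rev_ord i))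
    *: (u i * u (rev_ord i) * (x (rev_ord i) * x i)).
Proof.
rewrite /momentum rev_ordK -mulrA [x _ * (_ * _)]mulrA.
rewrite (qcomm_sym q0 (u_x (rev_ord i) (rev_ord i))).
by rewrite -scalerAl -scalerAr !mulrA.
Qed.

(** $\lambda_i\lambda_{-i}$ is $u_iu_{-i}$ times a combination of two neighbouring radii.
    Multiplication by $u_iu_{-i}$ turns each of them into the [c'] of the other one's index; this
    exchange is what inverts $q$. *)
Lemma momentum_plane : qplane qh^-1 (fun i => lam (rev_ord i)) c'.
Proof.
split=> [i j ij nij|i i0|i i0|i i0]; rewrite ?exprVn ?invrK ?rev_ordK.
- have ij' : rev_ord i != rev_ord j.
    by rewrite (inj_eq rev_ord_inj); apply: contraTneq ij => ->; rewrite ltxx.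
  have ir' : rev_ord i != rev_ord (rev_ord j).
    by rewrite (inj_eq rev_ord_inj).
  have := lam_lam ij' ir'; rewrite /qcomm !key_rev !ltrN2 ltNge (ltW ij) ij.
  by move=> ->.
- rewrite lam_prod (qp_neg x_plane i0) uexp_diag key_rev oppr_gt0 oppr_lt0 ltNge.
  rewrite (ltW i0) i0 /= mulrBr -scalerAr.
  have := u_u_c i; have := u_u_c' i; rewrite /frame_index oppr_gt0 i0 ltNge (ltW i0) /=.
  rewrite abszN gt_eqF // => -> ->.
  rewrite scalerBr !scalerA -[q ^ _]/(q ^- 2) addrC -!scaleNr -[X in _ = X + _]scale1r.
  by congr (_ *: _ + _ *: _); field.
- have := lam_prod (rev_ord i); rewrite rev_ordK => ->.
  rewrite (qp_pos x_plane i0) uexp_diag i0 expr0z scale1r mulrBr -scalerAr u_u.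
  have := u_u_c i; have := u_u_c' i; rewrite /frame_index oppr_gt0 i0 ltNge (ltW i0) /=.
  rewrite abszN gt_eqF // => -> ->.
  rewrite scalerA addrC -!scaleNr -[X in _ = X + _]scale1r.
  by congr (_ *: _ + _ *: _); field.
have := lam_prod (rev_ord i); rewrite rev_ordK => ->.
rewrite (qp_zero x_plane i0) uexp_diag i0 ltxx -scalerAr u_u.
have := u_u_c i; rewrite i0 /= => ->; rewrite !scalerA; congr (_ *: _).
by case: ifP => _; rewrite ?exprN1 ?expfz_n2; field.
Qed.

(** The sign in [- x (rev_ord h)] keeps the bracket:
    $[-x^{-h},\lambda_{-h}]=[\lambda_{-h},x^{-h}]$. *)
Lemma momentum_frame h :
  qframe qh^-1 (fun i => lam (rev_ord i)) c' h (- x (rev_ord h)) (D (rev_ord h)).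
Proof.
have reqE (i j : 'I_N) : (rev_ord i == j) = (i == rev_ord j).
  by rewrite -(inj_eq rev_ord_inj) rev_ordK.
split=> [i ih|i hi ih||i||]; rewrite ?exprVn ?invrK.
- have ih' : rev_ord h != rev_ord i.
    by rewrite (inj_eq rev_ord_inj); apply: contraTneq ih => ->; rewrite ltxx.
  have := lam_x ih'; rewrite !key_rev ltrN2 ih /qcomm mulrN mulNr scalerN => ->.
  by rewrite scalerA -[q ^ 2]/(q ^+ 2) mulVf ?expf_neq0 // scale1r.
- have ih' : rev_ord h != rev_ord i by rewrite (inj_eq rev_ord_inj) eq_sym.
  have := lam_x ih'; rewrite !key_rev ltrN2 ltNge hi /= => /qcomm0.
  by rewrite mulrN mulNr => ->.
- by rewrite -lam_comm mulrN mulNr opprK addrC.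
- rewrite (D_lam (rev_ord h) (rev_ord i)) !rev_ordK !(reqE, rev_ordK).
  congr (_ *: _); case: (i =P h) => _; case: (i =P rev_ord h) => _.
  + by rewrite -[q ^ _]/(q^-1); field.
  + by rewrite -[q ^ _]/(q ^- 2); field.
  + by rewrite -[q ^ _]/(1 : C); field.
  + by rewrite -[q ^ _]/(q^-1) !mulr1.
- rewrite (D_lam (rev_ord h) (rev_ord (rev_ord h))) !rev_ordK lam_D c'_x.
  rewrite mulNr scalerN -scaleNr !scalerA eqxx uexp_rev rev_fix; congr (_ *: _).
  rewrite /frame_coef; case: (ltrgtP 0 (key h)) => h0.
  + rewrite andbF -[q ^ (-1 + _ - _)]/(1 : C) -[q ^ _]/(q ^+ 4) exprVn invrK.
    by field.
  + by rewrite andbF -[q ^ (-1 + _ - _)]/(1 : C) -[q ^ _]/(q ^+ 2); field.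
  + rewrite andbT eta_inv /eta_; case: (odd N).
      by rewrite -[q ^ (-1 + _ - _)]/(q^-1) -[q ^ _]/(q ^+ 2); field.
    by rewrite -[q ^ (-1 + _ - _)]/(1 : C) -[q ^ _]/(q ^+ 2) invr1; field.
- by rewrite rev_ordK lam_D mulrN scalerN scaleNr.
Qed.

(** The two values of [Dcoef], the scalar in [u_u_c] and the power of $q$ from reordering multiply
    to $k^2q^{-2}$ at every key; this is the origin of the constant $q^2k^{-2}$. *)
Lemma Dmom_norm (Lam : A) :
  (forall j, (j <= N.-1./2)%N -> Lam * Lam * (c' j * c j) = (q ^+ 2 / k ^+ 2) *: 1) ->
  forall i, Lam * Lam * (D i * D (rev_ord i)) = 1.
Proof.
move=> Lcc i.
have := u_u_c i; have jN := frame_index_leN i; have jN' := frame_index_le i.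
have -> : D i * D (rev_ord i) = (Dcoef (key i) * Dcoef (- key i) * q ^ (-2)) *:
  (u i * u (rev_ord i) * c (frame_index (key i)) * c (frame_index (- key i))).
  rewrite /Dmom -!scalerAl -!scalerAr !scalerA key_rev.
  rewrite -[u i * c _ * _]mulrA [c _ * (u _ * _)]mulrA (qcomm_sym q0 (u_c (rev_ord i) jN')).
  by rewrite -scalerAl -scalerAr scalerA !mulrA.
move=> _; rewrite u_u_c' -!scalerAl -!scalerAr Lcc // !scalerA.
rewrite -[RHS]scale1r; congr (_ *: _); rewrite expfz_n2 /Dcoef oppr_gt0 oppr_lt0.
move: (q - q^-1) k0 => kk kk0; case: (ltrgtP 0 (key i)) => _.
- by field; rewrite kk0 qh0.
- by field; rewrite kk0 qh0.
by rewrite /eta_; case: (odd N); field; rewrite kk0 qh0.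
Qed.

End Momenta.

(** * Frames in the quantum Euclidean algebra *)

Section Euclid.
Variables (C : fieldType) (A : algType C) (N : nat) (qh : C).
Local Notation q := (qh ^+ 2).
Local Notation k := (q - q^-1).
Local Notation eta := (eta_ N qh).
Local Notation tau := (tau_ qh).
Local Notation qc := (qcomm q).
Variables (x : 'I_N -> A) (r rV : nat -> A) (Lam LamV K KV : A).
Variable (gam : 'I_N -> C).

(** This is $\omega$ at the index of the radius, except at $j=0$ for [N] odd, where it is
    $q^{1/2}+q^{-1/2}$ and not $\omega_0=2$. Since $k=h(q^{1/2}+q^{-1/2})$, the separate formulas of
    the odd case for $[x^1,x^{-1}]$, $\bar\gamma_0$ and $\bar\gamma_1\bar\gamma_{-1}$ thereby take
    the general form. *)
Definition radial_weight (j : nat) : C := q ^+ j / eta + eta / q ^+ j.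
Local Notation w := radial_weight.

Hypotheses (N_gt1 : (1 < N)%N) (qh0 : qh != 0) (k0 : k != 0)
  (w0 : forall j, w j != 0).
Hypotheses
  (xx : forall i j, idx i < idx j -> i != rev_ord j -> x i * x j = q *: (x j * x i))
  (xcomm : forall i, 1 < idx i -> x i * x (rev_ord i) - x (rev_ord i) * x i =
     (k_ q * (omega qh N (idx i - 1))^-1) *: r (`|idx i| - 1)%N ^+ 2)
  (x1comm : forall i, idx i = 1 -> x i * x (rev_ord i) - x (rev_ord i) * x i =
     if odd N then h_ qh *: r 0%N ^+ 2 else 0)
  (r2 : forall j, rvalid N j -> r j ^+ 2 =
     \sum_(i | (`|idx i| <= j)%N) \sum_(l | (`|idx l| <= j)%N)
       metric qh i l *: (x i * x l))
  (r0 : forall i, odd N -> idx i = 0 -> r 0%N = x i)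
  (xr : forall i j, rvalid N j -> `|idx i| <= j%:Z -> x i * r j = r j * x i)
  (xr_lt : forall i j, rvalid N j -> idx i < - j%:Z -> x i * r j = q *: (r j * x i))
  (xr_gt : forall i j, rvalid N j -> j%:Z < idx i -> x i * r j = q^-1 *: (r j * x i))
  (rr : forall i j, rvalid N i -> rvalid N j -> r i * r j = r j * r i)
  (rrV : forall j, rvalid N j -> r j * rV j = 1)
  (rVr : forall j, rvalid N j -> rV j * r j = 1)
  (LLV : Lam * LamV = 1) (LVL : LamV * Lam = 1)
  (xL : forall i, x i * Lam = q *: (Lam * x i))
  (rL : forall j, rvalid N j -> r j * Lam = q *: (Lam * r j)).
Hypotheses
  (KKV : ~~ odd N -> K * KV = 1) (KVK : ~~ odd N -> KV * K = 1)
  (Kx1 : forall i, ~~ odd N -> idx i = 1 -> K * x i = q *: (x i * K))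
  (KxN1 : forall i, ~~ odd N -> idx i = - 1 -> K * x i = q^-1 *: (x i * K))
  (Kx : forall i, ~~ odd N -> 1 < `|idx i| -> K * x i = x i * K)
  (Kr : forall j, ~~ odd N -> rvalid N j -> K * r j = r j * K)
  (KL : ~~ odd N -> K * Lam = Lam * K).
Hypotheses
  (gam_0 : forall a : 'I_N, odd N -> idx a = 0 -> gam a = qh * (h_ qh)^-1)
  (gam_1 : forall a : 'I_N, idx a = 1 ->
     gam a * gam (rev_ord a) =
       if odd N then - q * (h_ qh) ^- 2 else (k_ q) ^- 2)
  (gam_gt1 : forall a : 'I_N, 1 < idx a ->
     gam a * gam (rev_ord a) =
       - q * (k_ q) ^- 2 * omega qh N (idx a) * omega qh N (idx a - 1)).

Let q0 : q != 0. Proof. by rewrite expf_neq0. Qed.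
Let N_gt0 : (0 < N)%N. Proof. exact: ltnW. Qed.

(** Radii are counted by keys from here on: for [N] even, [R 0] is $r_1$. *)
Definition shift (j : nat) : nat := (j + ~~ odd N)%N.
Local Notation R := (fun j => r (shift j)).
Local Notation V := (fun j => rV (shift j)).

Lemma shift_valid j : (j <= N.-1./2)%N -> rvalid N (shift j).
Proof. by rewrite /rvalid /shift; lia. Qed.

Definition rnorm (j : nat) : A := (w j)^-1 *: (R j * R j).
(** The squared radius of the momenta: the inverse of [rnorm j], up to $\Lambda^{-2}$ and the
    constant of [Dmom_norm]. *)
Definition rnormV (j : nat) : A :=
  (q ^+ 2 / k ^+ 2 * w j) *: (LamV * LamV * (V j * V j)).

Definition kap (h : 'I_N) : A :=
  if ~~ odd N && (key h == 0) then (if idx h == 1 then K else KV) else 1.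
(** In the factor $2q$, the 2 comes from $(x^{\pm1})^{-1}=2r_1^{-2}x^{\mp1}$ and the $q$ from moving
    $x^{\mp1}$ to the right across $K^{\pm1}$. *)
Definition gcoef (h : 'I_N) : C :=
  (if ~~ odd N && (key h == 0) then q *+ 2 else 1) * gam h.
(** At key 0 the predecessor is truncated to 0, so that the radial part is the square of [V 0], in
    agreement with $(x^0)^{-1}=r_0^{-2}x^0$ for [N] odd and $(x^{\pm1})^{-1}=2r_1^{-2}x^{\mp1}$ for
    [N] even. *)
Definition ufactor (h : 'I_N) : A :=
  gcoef h *: (LamV * (V `|key h|%N * V `|key h|%N.-1) * kap h).
Local Notation c := rnorm.
Local Notation u := ufactor.

Lemma absz_key_le (h : 'I_N) : (`|key h|%N <= N.-1./2)%N /\ (`|key h|%N.-1 <= N.-1./2)%N.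
Proof. by have := key_le h; lia. Qed.

Lemma xR i j : (j <= N.-1./2)%N -> qc (x i) (R j) (- rexp j (key i)).
Proof.
move=> jN; have v := shift_valid jN; rewrite /qcomm.
have e : rexp j (key i) = ((shift j)%:Z < idx i)%R%:Z - (idx i < - (shift j)%:Z)%R%:Z.
  by rewrite /rexp idx_key /key /shift; case: ltnP => ?; case: (odd N) => /=; lia.
rewrite e; case: (ltrP (shift j)%:Z (idx i)) => [gt|le].
  have -> : (idx i < - (shift j)%:Z)%R = false by lia.
  by rewrite (xr_gt v gt).
case: (ltrP (idx i) (- (shift j)%:Z)) => [lt|ge]; first by rewrite (xr_lt v lt).
by rewrite xr ?expr0z ?scale1r //; lia.
Qed.

Lemma Rx i j : (j <= N.-1./2)%N -> qc (R j) (x i) (rexp j (key i)).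
Proof. by move=> jN; rewrite -[rexp _ _]opprK; apply/qcomm_sym/xR. Qed.
Lemma Vx i j : (j <= N.-1./2)%N -> qc (V j) (x i) (- rexp j (key i)).
Proof.
by move=> jN; apply: (qcomm_inv q0 (rrV _) (rVr _) (Rx i jN)); exact: shift_valid.
Qed.
Lemma LVx i : qc LamV (x i) 1.
Proof.
apply: (qcomm_eq (z := - - 1)) => //; apply: (qcomm_inv q0 LLV LVL).
by apply: qcomm_sym => //; rewrite /qcomm expr1z.
Qed.
Lemma RLam j : (j <= N.-1./2)%N -> qc (R j) Lam 1.
Proof. by move=> jN; rewrite /qcomm expr1z rL ?shift_valid. Qed.
Lemma LVR j : (j <= N.-1./2)%N -> qc LamV (R j) 1.
Proof.
move=> jN; apply: (qcomm_eq (z := - - 1)) => //; apply: (qcomm_inv q0 LLV LVL).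
exact/qcomm_sym/RLam.
Qed.
Lemma VLV j : (j <= N.-1./2)%N -> qc (V j) LamV 1.
Proof.
move=> jN; apply: (qcomm_eq (z := - (- 1))) => //.
apply: (qcomm_inv q0 (rrV _) (rVr _)); try exact: shift_valid.
exact/qcomm_sym/LVR.
Qed.
Lemma RR i j : (i <= N.-1./2)%N -> (j <= N.-1./2)%N -> qc (R i) (R j) 0.
Proof. by move=> iN jN; apply/qcomm0/rr; exact: shift_valid. Qed.
Lemma VR i j : (i <= N.-1./2)%N -> (j <= N.-1./2)%N -> qc (V i) (R j) 0.
Proof.
move=> iN jN; apply: (qcomm_inv q0 (rrV _) (rVr _) (RR iN jN)); exact: shift_valid.
Qed.
Lemma VV i j : (i <= N.-1./2)%N -> (j <= N.-1./2)%N -> qc (V i) (V j) 0.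
Proof.
move=> iN jN; apply: (qcomm_sym q0 (z := 0)).
apply: (qcomm_inv q0 (rrV _) (rVr _) (z := 0)); try exact: shift_valid.
exact: (qcomm_sym q0 (VR iN jN)).
Qed.
Lemma VL j : (j <= N.-1./2)%N -> qc (V j) Lam (- 1).
Proof.
by move=> jN; apply: (qcomm_inv q0 (rrV _) (rVr _) (RLam jN)); exact: shift_valid.
Qed.

Lemma kap_comm h y : (~~ odd N -> K * y = y * K) -> qc (kap h) y 0.
Proof.
rewrite /kap => Ky; case: ifP => [/andP[eN _]|_]; last by apply/qcomm0; rewrite mul1r mulr1.
case: ifP => _; first exact/qcomm0/Ky.
by apply: (qcomm_inv q0 (z := 0) (KKV eN) (KVK eN)); exact/qcomm0/Ky.
Qed.

Lemma kapV h j : (j <= N.-1./2)%N -> qc (kap h) (V j) 0.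
Proof.
move=> jN; apply: kap_comm => eN; have v := shift_valid jN.
rewrite -[K * _]mul1r -(rVr v) -!mulrA [r _ * (K * _)]mulrA -Kr //.
by rewrite -mulrA rrV // mulr1.
Qed.

Lemma kapR h j : (j <= N.-1./2)%N -> qc (kap h) (R j) 0.
Proof. by move=> jN; apply: kap_comm => eN; rewrite Kr ?shift_valid. Qed.

Lemma kapL h : qc (kap h) Lam 0.
Proof. exact: kap_comm. Qed.

Lemma kapLV h : qc (kap h) LamV 0.
Proof.
apply: kap_comm => eN.
by rewrite -[K * _]mul1r -LVL -!mulrA [Lam * (K * _)]mulrA -KL // -!mulrA LLV mulr1.
Qed.

Lemma kapx h i : qc (kap h) (x i) ((key h == 0)%:Z * ((i == h)%:Z - (i == rev_ord h)%:Z)).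
Proof.
rewrite /kap; have [oN|eN] := boolP (odd N) => /=.
  apply: (qcomm_eq (z := 0)); first by apply/qcomm0; rewrite mul1r mulr1.
  case: eqP => [h0|]; last by lia.
  by have := rev_fix h; rewrite oN h0 eqxx => /eqP <-; lia.
have [h0|_] := eqVneq (key h) 0; last first.
  by apply: (qcomm_eq (z := 0)); [apply/qcomm0; rewrite mul1r mulr1 | lia].
have ih : (i == h) = (idx i == idx h).
  by rewrite -val_eqE /= /idx /=; case: (i) (h) => i0 /= ? [h' /= ?]; lia.
have ir : (i == rev_ord h) = (idx i == - idx h).
  by rewrite -idx_rev -val_eqE /= /idx /=; case: (i) (h) => i0 /= ? [h' /= ?]; lia.
have i1 : idx h = 1 \/ idx h = -1 by move: h0; rewrite idx_key => ->; rewrite eN; case: ifP; lia.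
have iN0 : idx i != 0 by rewrite /idx eN; lia.
have Ki : qc K (x i) ((idx i == 1)%:Z - (idx i == -1)%:Z).
  rewrite /qcomm; case: (eqVneq (idx i) 1) => [e|ne].
    by rewrite e Kx1.
  case: (eqVneq (idx i) (-1)) => [e|ne']; first by rewrite KxN1.
  by rewrite Kx ?expr0z ?scale1r //; lia.
case: (eqVneq (idx h) 1) => [e|ne].
  by apply: qcomm_eq Ki _; rewrite ih ir e; lia.
have e : idx h = -1 by case: i1 ne => // ->; rewrite eqxx.
by apply: qcomm_eq (qcomm_inv q0 (KKV eN) (KVK eN) Ki) _; rewrite ih ir e; lia.
Qed.

Lemma rnorm_x j i : (j <= N.-1./2)%N -> qc (c j) (x i) (2 * rexp j (key i)).
Proof.
move=> jN; apply/qcommZl; apply: qcomm_eq.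
  exact: (qcommMl q0 (Rx i jN) (Rx i jN)).
by lia.
Qed.

Lemma ufactor_x h i : qc (u h) (x i) (uexp h i).
Proof.
have [b1 b2] := absz_key_le h; apply/qcommZl; apply: qcomm_eq.
  apply: (qcommMl q0 _ (kapx h i)); apply: (qcommMl q0 (LVx i)).
  exact: (qcommMl q0 (Vx i b1) (Vx i b2)).
by rewrite /uexp; lia.
Qed.

Lemma ufactor_c h j : (j <= N.-1./2)%N -> qc (u h) (c j) 2.
Proof.
move=> jN; have [b1 b2] := absz_key_le h; apply/qcommZl/qcommZr.
suff H : qc (LamV * (V `|key h|%N * V `|key h|.-1%N) * kap h) (R j) 1.
  exact: (qcommMr q0 H H).
apply: (qcomm_eq (z := 1 + (0 + 0) + 0)); last by [].
apply: (qcommMl q0 _ (kapR h jN)); apply: (qcommMl q0 (LVR jN)).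
exact: (qcommMl q0 (VR b1 jN) (VR b2 jN)).
Qed.

Lemma kap_kap h i : qc (kap h) (kap i) 0.
Proof.
apply: kap_comm => eN; rewrite /kap; case: ifP => _; last by rewrite mul1r mulr1.
by case: ifP => _; rewrite // KKV // KVK.
Qed.

(** Every [u h] carries one $\Lambda^{-1}$ and two inverse radii, so the exponents from the two
    sides cancel. *)
Lemma ufactor_u h i : u h * u i = u i * u h.
Proof.
have [b1 b2] := absz_key_le h; have [d1 d2] := absz_key_le i.
apply/(qcomm0 q)/qcommZl/qcommZr.
have kLVV : qc (kap h) (LamV * (V `|key i|%N * V `|key i|.-1%N) * kap i) 0.
  apply: (qcommMr q0 (z := 0) (z' := 0) _ (kap_kap h i)).
  apply: (qcommMr q0 (z := 0) (z' := 0) (kapLV h)).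
  exact: (qcommMr q0 (z := 0) (z' := 0) (kapV h d1) (kapV h d2)).
have Vu j : (j <= N.-1./2)%N ->
    qc (V j) (LamV * (V `|key i|%N * V `|key i|.-1%N) * kap i) 1.
  move=> jN; apply: (qcommMr q0 (z := 1) (z' := 0)).
    apply: (qcommMr q0 (z := 1) (z' := 0) (VLV jN)).
    exact: (qcommMr q0 (z := 0) (z' := 0) (VV jN d1) (VV jN d2)).
  exact: (qcomm_sym q0 (z := 0) (kapV i jN)).
have Lu : qc LamV (LamV * (V `|key i|%N * V `|key i|.-1%N) * kap i) (- 2).
  apply: (qcommMr q0 (z := - 2) (z' := 0)); last exact: (qcomm_sym q0 (z := 0) (kapLV i)).
  apply: (qcommMr q0 (z := 0) (z' := - 2)); first exact/qcomm0.
  exact: (qcommMr q0 (z := - 1) (z' := - 1) (qcomm_sym q0 (VLV d1)) (qcomm_sym q0 (VLV d2))).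
apply: (qcommMl q0 (z := 0) (z' := 0) _ kLVV).
apply: (qcommMl q0 (z := - 2) (z' := 2) Lu).
exact: (qcommMl q0 (z := 1) (z' := 1) (Vu _ b1) (Vu _ b2)).
Qed.

Lemma VR1 j : (j <= N.-1./2)%N -> V j * R j = 1.
Proof. by move=> jN; rewrite rVr ?shift_valid. Qed.

Lemma VR2 j : (j <= N.-1./2)%N -> V j * V j * (R j * R j) = 1.
Proof. by move=> jN; rewrite -mulrA [V j * (R j * _)]mulrA VR1 // mul1r VR1. Qed.

Lemma VVRR i j : (i <= N.-1./2)%N -> (j <= N.-1./2)%N ->
  V i * V j * (V i * V j) * (R j * R j) = V i * V i.
Proof.
move=> iN jN; have e : V i * V j = V j * V i by apply/(qcomm0 q)/VV.
rewrite {2}e -!mulrA; congr (_ * _).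
rewrite [V i * (R j * R j)]mulrA.
have -> : V i * R j = R j * V i by apply/(qcomm0 q)/VR.
rewrite -[R j * V i * _]mulrA.
have -> : V i * R j = R j * V i by apply/(qcomm0 q)/VR.
by rewrite !mulrA -[V j * V j * R j]mulrA VR1 // mulr1 VR1 // mul1r.
Qed.

Lemma omegaE j : (0 < j)%N || ~~ odd N -> omega qh N (shift j)%:Z = w j.
Proof.
move=> j0; rewrite /omega /qrho /radial_weight /eta_ /shift.
have -> : rho2 N (j + ~~ odd N)%N%:Z = (odd N)%:Z - (2 * j)%:Z.
  by rewrite /rho2 gtr0_sgz; move: j0; case: (odd N) => /=; lia.
rewrite expfzDr // -invr_expz -[qh ^ (2 * j)%:Z]/(qh ^+ (2 * j)) exprM.
by case: (odd N); rewrite ?mul1r ?divr1 ?invf_div ?invrK addrC // mulrC.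
Qed.

Lemma kE : k = h_ qh * (qh + qh^-1).
Proof. by rewrite /h_; field. Qed.

Lemma h0 : h_ qh != 0.
Proof. by apply: contraNneq k0; rewrite kE => ->; rewrite mul0r. Qed.

Lemma weight0 : odd N -> w 0 = qh + qh^-1.
Proof. by move=> oN; rewrite /radial_weight /eta_ oN expr0 divr1 mul1r addrC. Qed.

Lemma weight0e : ~~ odd N -> w 0 = 2.
Proof. by move=> eN; rewrite /radial_weight /eta_ (negbTE eN) expr0 divr1. Qed.

Lemma idx_shift (i : 'I_N) : 0 < key i -> idx i = (shift `|key i|%N)%:Z.
Proof. by rewrite idx_key /key /shift; case: i => i /= ?; case: ltnP; case: (odd N) => /=; lia. Qed.

Lemma gam_gam (a : 'I_N) : 0 < key a ->
  gam a * gam (rev_ord a) = - q / k ^+ 2 * w `|key a|%N * w `|key a|%N.-1.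
Proof.
move=> a0; have ia := idx_shift a0.
have [a1|a1] := ltrP 1 (idx a).
  rewrite gam_gt1 // ia omegaE; last by lia.
  have -> : (shift `|key a|%N)%:Z - 1 = (shift `|key a|%N.-1)%:Z by rewrite /shift; lia.
  by rewrite omegaE //; move: a1; rewrite ia /shift; case: (odd N); lia.
(* What is left is the index 1 for [N] odd, where $w_1=w_0=q^{1/2}+q^{-1/2}$. *)
have oN : odd N by move: a1; rewrite ia /shift; case: (odd N); lia.
have k1 : key a = 1 by move: a1; rewrite ia /shift oN; lia.
have i1 : idx a = 1 by rewrite ia /shift oN k1.
rewrite gam_1 // oN k1 /= weight0 // /radial_weight /eta_ oN expr1 kE.
have -> : q / qh + qh / q = qh + qh^-1 by field.
have h1 := h0; have : qh + qh^-1 != 0 by rewrite -weight0.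
move: (h_ qh) h1 (qh + qh^-1) => z z0 y y0.
by field; rewrite z0 y0.
Qed.

Lemma gcoef_gcoef h : gcoef h * gcoef (rev_ord h) =
  (if key h == 0 then q * (if odd N then 1 else q) else - q)
    / k ^+ 2 * w `|key h|%N * w `|key h|%N.-1.
Proof.
rewrite /gcoef key_rev oppr_eq0; case: (ltrgtP 0 (key h)) => hh.
- by rewrite andbF !mul1r gam_gam.
- rewrite andbF !mul1r [LHS]mulrC.
  have := @gam_gam (rev_ord h); rewrite rev_ordK key_rev abszN => -> //; lia.
rewrite -hh /= andbT; have [oN|eN] := boolP (odd N).
  have i0 : idx h = 0 by rewrite idx_odd.
  rewrite !gam_0 // ?idx_rev ?i0 ?oppr0 // !mul1r weight0 // kE.
  have h1 := h0; have : qh + qh^-1 != 0 by rewrite -weight0.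
  move: (h_ qh) h1 (qh + qh^-1) => z z0 y y0.
  by field; rewrite z0 y0.
have gg : gam h * gam (rev_ord h) = k ^- 2.
  have [i1|i1] : idx h = 1 \/ idx (rev_ord h) = 1.
    rewrite idx_rev; move: hh; rewrite idx_key eN => <-; case: ifP => _; lia.
  - by rewrite gam_1 // (negbTE eN).
  - by rewrite mulrC -{2}[h]rev_ordK gam_1 // (negbTE eN).
rewrite weight0e // mulrACA gg.
move: (q - q^-1) k0 => kk kk0.
by field; rewrite kk0.
Qed.

(** The product of the two [u] contains the inverse squares of two neighbouring radii; the factor
    [c] removes one of them, and the other one is that of [rnormV]. The weights in
    $\bar\gamma_a\bar\gamma_{-a}$ are removed or kept accordingly. *)
Lemma ufactor_ufactor_c h : u h * u (rev_ord h) * c (frame_index (- key h)) =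
     (if key h == 0 then q * (if odd N then 1 else q) else - q)
       *: rnormV (frame_index (key h)).
Proof.
have [b1 b2] := absz_key_le h.
have eW : V `|key h|%N * V `|key h|.-1%N = V `|key h|.-1%N * V `|key h|%N.
  by apply/(qcomm0 q)/VV.
(* [W] is abstract so that reassociation treats the two inverse radii as one factor. *)
have [W WE] : exists W, W = V `|key h|%N * V `|key h|.-1%N by eexists.
have kk1 : kap h * kap (rev_ord h) = 1.
  rewrite /kap key_rev oppr_eq0; case: ifP => [/andP[eN /eqP h0]|]; last by rewrite mulr1.
  rewrite idx_rev; have [-> /=|h1] := eqVneq (idx h) 1; first exact: KKV.
  rewrite ifT ?KVK //; move: h0 h1; rewrite idx_key => ->; rewrite eN; case: ifP; lia.
have uu : u h * u (rev_ord h) =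
    (gcoef h * gcoef (rev_ord h) * q ^+ 2) *: (LamV * LamV * (W * W)).
  rewrite /ufactor key_rev abszN -WE -!(scalerAl, scalerAr) !scalerA -[in RHS]scalerA.
  congr (_ *: _).
  have WL : W * LamV = q ^+ 2 *: (LamV * W).
    rewrite WE; exact: (qcommMl q0 (VLV b1) (VLV b2)).
  have kL : kap h * LamV = LamV * kap h by apply/(qcomm0 q)/kapLV.
  have kW : kap h * W = W * kap h.
    by rewrite WE; apply/(qcomm0 q)/(qcommMr q0 (kapV h b1) (kapV h b2)).
  rewrite -!mulrA [kap h * (LamV * _)]mulrA kL -!mulrA [kap h * (W * _)]mulrA kW.
  rewrite -!mulrA kk1 mulr1 [W * (LamV * _)]mulrA WL.
  by rewrite -scalerAl -scalerAr !mulrA.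
have WWR j0 j1 : (j0 <= N.-1./2)%N -> (j1 <= N.-1./2)%N -> W = V j0 * V j1 ->
    LamV * LamV * (W * W) * (R j1 * R j1) = LamV * LamV * (V j0 * V j0).
  by move=> jN0 jN1 ->; rewrite -mulrA VVRR.
rewrite uu gcoef_gcoef /rnorm /rnormV -!(scalerAl, scalerAr) !scalerA.
have scal (m w1 w2 : C) : w1 != 0 ->
    m / k ^+ 2 * w1 * w2 * q ^+ 2 * w1^-1 = m * (q ^+ 2 / k ^+ 2 * w2).
  by move=> w10; move: (q - q^-1) k0 => kk kk0; field; rewrite w10 kk0.
have [h0|h0] := ltrP 0 (key h).
  have -> : frame_index (- key h) = `|key h|%N.
    by rewrite /frame_index oppr_gt0 ltNge (ltW h0) abszN.
  have -> : frame_index (key h) = `|key h|%N.-1 by rewrite /frame_index h0.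
  by rewrite (WWR `|key h|%N.-1 `|key h|%N) // ?WE // scal.
have -> : frame_index (- key h) = `|key h|%N.-1.
  by rewrite /frame_index; case: ifP; lia.
have -> : frame_index (key h) = `|key h|%N by rewrite /frame_index ltNge h0.
rewrite (WWR `|key h|%N `|key h|%N.-1) // -(scal _ (w `|key h|%N.-1)) //.
by congr (_ *: _); rewrite -!mulrA; congr (_ * (_ * _)); rewrite mulrCA.
Qed.

Lemma r2_sum j : rvalid N j ->
  r j ^+ 2 = \sum_(i | (`|idx i| <= j)%N) tau i *: (x i * x (rev_ord i)).
Proof.
move=> /r2 ->; apply: eq_bigr => i ij.
rewrite (bigD1 (rev_ord i)) /=; last by rewrite idx_rev abszN.
rewrite big1 ?addr0 => [|l /andP[_ li]]; first by rewrite /metric rev_ordK eqxx qrho_tau.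
rewrite /metric ifF ?scale0r //; apply: contraNF li => /eqP ->.
by rewrite rev_ordK.
Qed.

Lemma shift_predK j : (0 < j)%N -> shift j = (shift j.-1).+1.
Proof. by rewrite /shift; lia. Qed.

Lemma radial_step (i : 'I_N) : 0 < key i ->
  R `|key i|%N * R `|key i|%N - R `|key i|%N.-1 * R `|key i|%N.-1 =
  tau i *: (x i * x (rev_ord i)) + (tau i)^-1 *: (x (rev_ord i) * x i).
Proof.
move=> i0; have [b1 b2] := absz_key_le i; rewrite -!expr2.
rewrite (r2_sum (shift_valid b1)) (r2_sum (shift_valid b2)).
have ii := idx_shift i0; have sK : shift `|key i|%N = (shift `|key i|%N.-1).+1.
  by apply: shift_predK; lia.
have ri : rev_ord i != i by rewrite eq_sym rev_fix; lia.
rewrite (bigD1 i) /=; last by rewrite ii.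
rewrite (bigD1 (rev_ord i)) /=; last by rewrite idx_rev ii abszN leqnn ri.
rewrite rev_ordK tau_rev // addrA.
rewrite (eq_bigl (fun l => (`|idx l| <= shift `|key i|%N.-1)%N)) ?addrK // => l.
rewrite sK; have : (l == i) = (idx l == idx i).
  by rewrite -val_eqE /= /idx /=; case: (i) (l) => i1 /= ? [l1 /= ?]; lia.
have : (l == rev_ord i) = (idx l == - idx i).
  by rewrite -idx_rev -val_eqE /= /idx /=; case: (i) (l) => i1 /= ? [l1 /= ?]; lia.
by move=> -> ->; rewrite ii; lia.
Qed.

Lemma radial_comm (i : 'I_N) : 0 < key i ->
  x i * x (rev_ord i) - x (rev_ord i) * x i = k *: c `|key i|%N.-1.
Proof.
move=> i0; have ii := idx_shift i0; rewrite /rnorm scalerA -expr2.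
have [i1|i1] := ltrP 1 (idx i).
  rewrite xcomm // ii.
  have -> : (shift `|key i|%N)%:Z - 1 = (shift `|key i|%N.-1)%:Z by rewrite /shift; lia.
  have -> : (`|(shift `|key i|%N)%:Z| - 1)%N = shift `|key i|%N.-1 by rewrite /shift; lia.
  by rewrite omegaE //; move: i1; rewrite ii /shift; case: (odd N); lia.
have oN : odd N by move: i1; rewrite ii /shift; case: (odd N); lia.
have k1 : key i = 1 by move: i1; rewrite ii /shift oN; lia.
have e1 : idx i = 1 by rewrite ii /shift oN k1.
rewrite x1comm // oN k1 /= /shift oN /= weight0 // kE mulfK //.
by rewrite -weight0.
Qed.

(** [radial_step] and [radial_comm] are two linear equations in the products $x^{\pm i}x^{\mp i}$.
    Eliminating one product leaves the other with the coefficient [tau i + (tau i)^-1], the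
    invertible weight of [key i]. *)
Lemma euclid_neg (i : 'I_N) : 0 < key i ->
  x (rev_ord i) * x i = c `|key i|%N - q *: c `|key i|%N.-1.
Proof.
move=> i0; have := radial_step i0; have := radial_comm i0.
move/eqP; rewrite subr_eq => /eqP ->.
have cR j : R j * R j = w j *: c j by rewrite scalerA mulfV ?scale1r.
have wE : w `|key i|%N = tau i + (tau i)^-1.
  rewrite tauE i0 /radial_weight -[q ^+ _]/(q ^ `|key i|%N%:Z) gtz0_abs //.
  by rewrite invfM invrK [eta / _]mulrC.
have wE' : w `|key i|%N.-1 + tau i * k = q * w `|key i|%N.
  rewrite wE tauE i0 /radial_weight.
  have -> : q ^+ `|key i|%N.-1 = q ^ key i / q.
    have kiE : key i = (`|key i|%N.-1.+1)%:Z by lia.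
    by rewrite [in RHS]kiE -[q ^ _]/(q ^+ (`|key i|%N.-1.+1)) (exprSr q) mulfK.
  have := eta_neq0 N qh0; have : q ^ key i != 0 by rewrite expfz_neq0.
  by move: (q ^ key i) (eta_ N qh) => t e t0 e0; field; rewrite t0 e0 qh0.
move=> H; have {}H : w `|key i|%N *: c `|key i|%N - w `|key i|%N.-1 *: c `|key i|%N.-1
    = (tau i * k) *: c `|key i|%N.-1 + w `|key i|%N *: (x (rev_ord i) * x i).
  by rewrite -!cR H scalerDr scalerA -addrA -scalerDl wE.
apply: (scalerI (w0 `|key i|%N)); rewrite scalerBr [w _ *: (q *: _)]scalerA [_ * q]mulrC -wE'.
by rewrite [(_ + tau i * k) *: _]scalerDl opprD addrA H [X in X - _]addrC addrK.
Qed.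

Lemma euclid_zero (i : 'I_N) : ~~ odd N -> key i = 0 ->
  x i * x (rev_ord i) = x (rev_ord i) * x i /\ x i * x (rev_ord i) = c 0%N.
Proof.
move=> eN i0; have v : rvalid N 1 by rewrite /rvalid eN; lia.
have ii : idx i = 1 \/ idx (rev_ord i) = 1.
  by rewrite idx_rev; move: i0; rewrite idx_key eN => ->; case: ifP => _; lia.
have xx' : x i * x (rev_ord i) = x (rev_ord i) * x i.
  case: ii => /x1comm; rewrite (negbTE eN) ?rev_ordK => /eqP; rewrite subr_eq0 => /eqP //.
have i0' : key (rev_ord i) = 0 by rewrite key_rev i0.
have ri : rev_ord i != i by rewrite eq_sym rev_fix (negbTE eN).
split=> //; have := r2_sum v; rewrite (bigD1 i) /=; last by case: ii; rewrite ?idx_rev; lia.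
rewrite (bigD1 (rev_ord i)) /=; last by rewrite ri andbT; case: ii; rewrite ?idx_rev; lia.
rewrite big_pred0 => [|l]; last first.
  have : (l == i) = (idx l == idx i).
    by rewrite -val_eqE /= /idx /=; case: (i) (l) => i1 /= ? [l1 /= ?]; lia.
  have : (l == rev_ord i) = (idx l == - idx i).
    by rewrite -idx_rev -val_eqE /= /idx /=; case: (i) (l) => i1 /= ? [l1 /= ?]; lia.
  have : idx l != 0 by rewrite /idx eN; lia.
  by move=> l0 -> ->; move: ii; rewrite idx_rev; lia.
rewrite addr0 rev_ordK !tauE i0 i0' /= expr0z mulr1 !scale1r -xx' => H.
by rewrite /rnorm /shift (negbTE eN) -expr2 H weight0e // -mulr2n -scaler_nat scalerA mulVf ?scale1r // -weight0e.
Qed.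

Lemma euclid_plane : qplane qh x c.
Proof.
split=> [i j ij nij|||i i0].
- by apply: xx => //; rewrite idx_lt key_ltW.
- exact: euclid_neg.
- move=> i i0; have := radial_comm i0; move/eqP; rewrite subr_eq => /eqP ->.
  rewrite euclid_neg // addrCA -scalerBl; congr (_ + _).
  by rewrite -scaleNr; congr (_ *: _); ring.
have [oN|eN] := boolP (odd N).
  have ii : idx i = 0 by rewrite idx_odd.
  have /eqP <- : i == rev_ord i by rewrite rev_fix oN i0 eqxx.
  by rewrite -r0 // /rnorm scalerA weight0 // mulfV ?scale1r /shift ?oN // -weight0.
by have [_ ->] := euclid_zero eN i0; rewrite scale1r.
Qed.

Lemma rnormV_rnorm j : (j <= N.-1./2)%N ->
  Lam * Lam * (rnormV j * c j) = (q ^+ 2 / k ^+ 2) *: 1.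
Proof.
move=> jN; rewrite /rnormV /rnorm -!(scalerAl, scalerAr) !scalerA mulfK //.
rewrite -!mulrA [V j * (R j * _)]mulrA VR1 // mul1r VR1 // mulr1.
by rewrite [Lam * (LamV * _)]mulrA LLV mul1r LLV.
Qed.

Lemma ufactor_Lam h : qc (u h) Lam (- 2).
Proof.
have [b1 b2] := absz_key_le h; apply/qcommZl.
apply: (qcommMl q0 (z := - 2) (z' := 0) _ (kapL h)).
apply: (qcommMl q0 (z := 0) (z' := - 2)); first by apply/qcomm0; rewrite LLV LVL.
exact: (qcommMl q0 (z := -1) (z' := -1) (VL b1) (VL b2)).
Qed.

Lemma Lam_momentum h : Lam * momentum x u h = q *: (momentum x u h * Lam).
Proof.
have H : qc (momentum x u h) Lam (- 1).
  apply: (qcommMl q0 (z := - 2) (z' := 1) (ufactor_Lam h)).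
  by rewrite /qcomm expr1z.
by rewrite (qcomm_sym q0 H) expr1z.
Qed.

(** This is the index 0 for [N] odd. [Dmom_norm] gives the square of this element; the prescribed
    value of $\bar\gamma_0$ itself, and not just of its square, fixes the sign. *)
Lemma Lam_Dmom i : i = rev_ord i -> Lam * Dmom qh u c i = 1.
Proof.
move=> /eqP; rewrite rev_fix => /andP[oN /eqP i0].
have ii : idx i = 0 by rewrite idx_odd.
rewrite /Dmom /ufactor /rnorm /kap /gcoef i0 oN /= mulr1 mul1r.
rewrite -!(scalerAl, scalerAr) !scalerA.
have -> : frame_index 0 = 0%N by [].
rewrite -[LamV * _ * _]mulrA [Lam * (LamV * _)]mulrA LLV mul1r VR2 //.
rewrite /Dcoef /= /eta_ oN gam_0 // weight0 // kE -[RHS]scale1r; congr (_ *: _).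
have h1 := h0; have : qh + qh^-1 != 0 by rewrite -weight0.
move: (h_ qh) h1 (qh + qh^-1) => z z0 y y0.
by field; rewrite z0 y0 qh0.
Qed.

Lemma momentumE h : momentum x u h =
  if odd N && (idx h == 0) then gam h *: (LamV * ainv (x h))
  else if ~~ odd N && (idx h == 1) then gam h *: (LamV * ainv (x h) * K)
  else if ~~ odd N && (idx h == - 1) then gam h *: (LamV * ainv (x h) * KV)
  else gam h *: (LamV * rV `|idx h|%N * rV (`|idx h| - 1)%N * x (rev_ord h)).
Proof.
rewrite /momentum /ufactor /gcoef.
have [kz|kn] := eqVneq (key h) 0; last first.
  have e : idx h = (if 0 < key h then (shift `|key h|%N)%:Z else - (shift `|key h|%N)%:Z).
    case: ltrP => kp; first exact: idx_shift.
    have kr : 0 < key (rev_ord h) by rewrite key_rev; lia.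
    by have := idx_shift kr; rewrite idx_rev key_rev abszN; lia.
  have a1 : `|idx h|%N = shift `|key h|%N by rewrite e; case: ifP; lia.
  have a2 : (`|idx h| - 1)%N = shift `|key h|%N.-1 by rewrite a1 /shift; lia.
  have z0 : (idx h == 0) = false by move: a1; rewrite /shift; lia.
  rewrite z0 a2 a1 /kap (negbTE kn) !andbF /= mul1r mulr1.
  rewrite !ifF; try by apply/negP => /andP[eN /eqP ih]; move: a1; rewrite ih /shift eN /=; lia.
  by rewrite -scalerAl !mulrA.
have [oN|eN] := boolP (odd N) => /=.
  have ii : idx h = 0 by rewrite idx_odd.
  have /eqP rh : h == rev_ord h by rewrite rev_fix oN kz eqxx.
  have xh : x h = R 0%N by rewrite -r0 // /shift oN.
  have v := @shift_valid 0 isT.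
  have -> : ainv (x h) = V 0%N by apply: ainv_eq; rewrite xh ?rrV ?rVr.
  rewrite ii /= -rh xh /kap oN /= mulr1 mul1r kz -scalerAl -!mulrA VR1 //.
  by rewrite mulr1.
have [xx' xc0] := euclid_zero eN kz.
have kz' : key (rev_ord h) = 0 by rewrite key_rev kz.
have w2 : w 0 = 2 := weight0e eN.
(* The inverse of $x^{\pm1}$ for [N] even, read off from $x^1x^{-1}=r_1^2/2$. *)
pose y := (2 : C) *: (V 0%N * V 0%N * x (rev_ord h)).
have VVx i : key i = 0 -> x i * (V 0%N * V 0%N) = V 0%N * V 0%N * x i.
  move=> ki; apply/(qcomm0 q)/(qcomm_sym q0 (z := 0)).
  have H := @Vx i 0 isT; rewrite ki in H.
  exact: (qcommMl q0 (z := 0) (z' := 0) H H).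
have VVc : V 0%N * V 0%N * c 0%N = 2^-1 *: 1.
  by rewrite /rnorm w2 -scalerAr VR2.
have t0 : (2 : C) != 0 by rewrite -w2.
have y1 : x h * y = 1.
  by rewrite /y -scalerAr mulrA VVx // -[_ * x h * _]mulrA xc0 VVc scalerA mulfV // scale1r.
have y2 : y * x h = 1.
  by rewrite /y -scalerAl -[_ * x (rev_ord h) * _]mulrA -xx' xc0 VVc scalerA mulfV // scale1r.
have -> : ainv (x h) = y by apply: ainv_eq.
have kx : x (rev_ord h) * kap h = q *: (kap h * x (rev_ord h)).
  have ri : rev_ord h != h by rewrite eq_sym rev_fix (negbTE eN).
  have := kapx h (rev_ord h); rewrite kz (negbTE ri) !eqxx => /(qcomm_sym q0) ->.
  by [].
have main : (q *+ 2 * gam h) *: (LamV * (V 0%N * V 0%N) * kap h) * x (rev_ord h) =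
    gam h *: (LamV * y * kap h).
  rewrite /y -!scalerAr -!scalerAl scalerA -!mulrA kx -!scalerAr !scalerA.
  by congr (_ *: _); ring.
rewrite kz /= main /kap eN kz /=.
have [i1|i1] : idx h = 1 \/ idx h = -1.
  by move: kz; rewrite idx_key eN => ->; case: ifP => _; lia.
- by rewrite i1.
- by rewrite i1.
Qed.

Local Notation lam := (momentum x u).
Local Notation D := (Dmom qh u c).

(** [lambda_bar] with elements of an arbitrary algebra in place of the generators. *)
Definition lambda (h : 'I_N) : A :=
  if odd N && (idx h == 0) then gam h *: (LamV * ainv (x h))
  else if ~~ odd N && (idx h == 1) then gam h *: (LamV * ainv (x h) * K)
  else if ~~ odd N && (idx h == - 1) then gam h *: (LamV * ainv (x h) * KV)
  else gam h *: (LamV * rV `|idx h|%N * rV (`|idx h| - 1)%N * x (rev_ord h)).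

Definition Lambda_comm (i j : 'I_N) : A :=
  \sum_h \sum_l (metric qh i h * metric qh l j) *:
    (Lam * (lambda h * x l - x l * lambda h)).

Lemma Lambda_commE i j : Lambda_comm i j = Lreal qh x lam Lam i j.
Proof.
rewrite /Lambda_comm (bigD1 (rev_ord i)) //= [X in _ + X]big1 ?addr0 => [|h hi].
  rewrite (bigD1 (rev_ord j)) //= [X in _ + X]big1 ?addr0 => [|l lj].
    rewrite /metric !rev_ordK !eqxx !qrho_tau // tau_rev //.
    by rewrite /Lreal /comm_lam /lambda -momentumE.
  by rewrite /metric (negbTE lj) mulr0 scale0r.
apply: big1 => l _; rewrite /metric ifF ?mul0r ?scale0r //.
by apply: contraNF hi => /eqP ->; rewrite rev_ordK.
Qed.

Lemma euclid_realization (L := Lambda_comm) :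
  [/\ forall i j, idx j < idx i -> L i j = 0,
      \prod_(i < N) L i i = 1,
      forall i h, \sum_j \sum_l metric qh l j *: (L i j * L h l)
        = metric qh h i *: 1
    & forall i h, \sum_j \sum_l metric qh l j *: (L j i * L l h)
        = metric qh h i *: 1] /\
  [/\ forall a b e f, \sum_s \sum_t Rhat q qh a b s t *: (L t f * L s e)
        = \sum_s \sum_t Rhat q qh t s e f *: (L b s * L a t),
      forall i a b, x i * L a b
        = \sum_j \sum_m Rhat q qh j i m b *: (L a j * x m)
    & forall a b, Lam * L a b = L a b * Lam].
Proof.
have -> : L = Lreal qh x lam Lam.
  by apply: boolp.funext => i; apply: boolp.funext => j; exact: Lambda_commE.
have pl := euclid_plane; have rx := rnorm_x; have ux := ufactor_x.
have uc := ufactor_c; have uu := ufactor_u; have uuc := ufactor_ufactor_c.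
have rVr1 := rnormV_rnorm; have LD := Lam_Dmom; have Ll := Lam_momentum.
have xf h : qframe qh x c h (lam h) (D h).
  by apply: x_frame; first [done | eassumption].
have lp : qplane qh^-1 (fun i => lam (rev_ord i)) rnormV.
  by apply: momentum_plane; first [done | eassumption].
have lf h : qframe qh^-1 (fun i => lam (rev_ord i)) rnormV h (- x (rev_ord h)) (D (rev_ord h)).
  by apply: momentum_frame; first [done | eassumption].
have LDD i : Lam * Lam * (D i * D (rev_ord i)) = 1.
  by apply: Dmom_norm; first [done | eassumption].
split; split.
- by move=> i j ij; apply: Lreal_tri; first [done | eassumption].
- by apply: Lreal_det; first [done | eassumption].
- by move=> i h; apply: Lreal_metric_up; first [done | eassumption].
- by move=> i h; apply: Lreal_metric_lo; first [done | eassumption].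
- by move=> a b e f; apply: Lreal_RLL; first [done | eassumption].
- by move=> i a b; apply: x_Lreal; first [done | eassumption].
- by move=> a b; apply: Lreal_Lam; first [done | eassumption].
Qed.

End Euclid.

(** * Homomorphisms between presented algebras *)

Section FreeLift.
Variables (C : fieldType) (X Y : choiceType) (f : X -> free_alg C Y).

Definition wordlift (m : {fmonom X}) : free_alg C Y := \prod_(i <- m) f i.

Lemma wordlift_mmorphism : mmorphism wordlift.
Proof.
split=> [m1 m2|]; first by rewrite /wordlift fmM big_cat.
by rewrite /wordlift fm1 big_nil.
Qed.
HB.instance Definition _ :=
  isMultiplicative.Build {fmonom X} (free_alg C Y) wordlift wordlift_mmorphism.

Definition freelift : free_alg C X -> free_alg C Y :=
  mmap (@malgC {fmonom Y} C) wordlift.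

Lemma freelift_is_zmod_morphism : zmod_morphism freelift.
Proof. exact: mmapB. Qed.

Lemma freelift_is_monoid_morphism : monoid_morphism freelift.
Proof.
have [] := @commr_mmap_is_multiplicative _ _ _
  (@malgC {fmonom Y} C) wordlift (fun u m m' => malgC_comm _ _).
by [].
Qed.
HB.instance Definition _ :=
  GRing.isZmodMorphism.Build _ _ freelift freelift_is_zmod_morphism.
HB.instance Definition _ :=
  GRing.isMonoidMorphism.Build _ _ freelift freelift_is_monoid_morphism.

Lemma freeliftZ : scalable freelift.
Proof. by move=> s u; rewrite /freelift mmapZ mul_malgC. Qed.

Lemma freelift_gen i : freelift (fgen C i) = f i.
Proof. by rewrite /freelift /fgen mmapU mul_malgC scale1r /= /wordlift fmU big_seq1. Qed.
End FreeLift.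

Lemma word_gen (C : fieldType) (X : choiceType) (m : {fmonom X}) :
  << m >> = \prod_(i <- m) fgen C i.
Proof.
case: m => s; elim: s => [|i s IH].
  rewrite big_nil -[RHS](rmorph1 (@malgC {fmonom X} C)).
  by congr << _ *g _ >>; apply/val_inj; rewrite /= fm1.
rewrite big_cons /= -IH /fgen malgM_def fgmulUU mulr1.
by congr << _ *g _ >>; apply/val_inj; rewrite /= fmM fmU.
Qed.

Lemma freelift_freemap (C : fieldType) (X Y : choiceType) (g : X -> Y)
    (f : Y -> free_alg C X) :
  (forall i, f (g i) = fgen C i) -> cancel (freemap g) (freelift f).
Proof.
move=> fg u.
transitivity (freelift f (freemap g (\sum_(m <- finmap.enum_fset (msupp u)) << u@_m *g m >>))).
  by rewrite -monalgE.
rewrite [RHS]monalgE (raddf_sum (freemap g)) (raddf_sum (freelift f)).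
apply: eq_bigr => m _.
have e1 (a : C) : freemap g << a *g m >> = a%:MP * wordmap C g m.
  exact: mmapU.
have e2 (a : C) : freelift f a%:MP = a%:MP by exact: mmapC.
apply: (etrans (congr1 (freelift f) (e1 _))).
apply: (etrans (rmorphM (freelift f) _ _)).
apply: (etrans (congr2 *%R (e2 _) (_ : _ = \prod_(i <- m) fgen C i))).
  apply: (etrans (rmorph_prod (freelift f) _ _ _)).
  by apply: eq_bigr => i _; apply: (etrans (freelift_gen _ _)).
by rewrite -word_gen malgM_def fgmulUU mulr1 mul1m.
Qed.

Section Induced.
Variables (C : fieldType) (X Y : choiceType).
Variables (relX0 : free_alg C X -> free_alg C X -> Prop).
Variables (relY : free_alg C Y -> free_alg C Y -> Prop).
Variable f : X -> free_alg C Y.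

(** The values of [f] are representatives: the target may be the zero ring, so the substitution is
    made in a free algebra and projected afterwards. *)
Definition lift_pi (u : free_alg C X) : presented relY :=
  \pi_(presented relY) (freelift f u).

Lemma lift_piB u v : lift_pi (u - v) = lift_pi u - lift_pi v.
Proof. exact: (etrans (congr1 _ (raddfB (freelift f) u v)) (piB _ _ _)). Qed.
Lemma lift_piM u v : lift_pi (u * v) = lift_pi u * lift_pi v.
Proof. exact: (etrans (congr1 _ (rmorphM (freelift f) u v)) (piM _ _ _)). Qed.
Lemma lift_pi1 : lift_pi 1 = 1.
Proof. exact: (etrans (congr1 _ (rmorph1 (freelift f))) (pi1 _)). Qed.
Lemma lift_piZ s u : lift_pi (s *: u) = s *: lift_pi u.
Proof. exact: (etrans (congr1 _ (freeliftZ f s u)) (piZ _ _ _)). Qed.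
Lemma lift_pi0 : lift_pi 0 = 0.
Proof. by have := lift_piB 0 0; rewrite subrr subrr. Qed.

Hypothesis f_rel : forall u v, relX0 u v -> lift_pi u = lift_pi v.

Definition induced (a : presented relX0) : presented relY := lift_pi (repr a).

Lemma induced_relators u : in_relators relX0 u -> lift_pi u = 0.
Proof.
elim=> [{}u v /f_rel uv||{}u v _ IHu _ IHv|a {}u b _ IH].
- by rewrite lift_piB uv subrr.
- exact: lift_pi0.
- by rewrite lift_piB IHu IHv subrr.
- by rewrite !lift_piM IH mulr0 mul0r.
Qed.

Lemma induced_pi u : induced (\pi_(presented relX0) u) = lift_pi u.
Proof.
apply/eqP; rewrite /induced -subr_eq0 -lift_piB.
exact/eqP/induced_relators/repr_relators.
Qed.

Lemma induced_zmod : zmod_morphism induced.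
Proof.
move=> a b; rewrite -[a]reprK -[b]reprK.
apply: (etrans (congr1 induced (esym (piB _ _ _)))).
by rewrite !induced_pi lift_piB.
Qed.

Lemma induced_monoid : monoid_morphism induced.
Proof.
split=> [|a b].
  apply: (etrans (congr1 induced (esym (pi1 _)))).
  by rewrite induced_pi lift_pi1.
rewrite -[a]reprK -[b]reprK.
apply: (etrans (congr1 induced (esym (piM _ _ _)))).
by rewrite !induced_pi lift_piM.
Qed.

Lemma induced_scale : scalable induced.
Proof.
move=> s a; rewrite -[a]reprK.
apply: (etrans (congr1 induced (esym (piZ _ _ _)))).
by rewrite !induced_pi lift_piZ.
Qed.

HB.instance Definition _ := GRing.isZmodMorphism.Build _ _ induced induced_zmod.
HB.instance Definition _ := GRing.isMonoidMorphism.Build _ _ induced induced_monoid.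

Definition induced_rmorphism : {rmorphism presented relX0 -> presented relY} :=
  induced.
End Induced.

(** * Equations in a presented algebra from its relations *)

Section Projection.
Variables (C : fieldType) (X : choiceType) (rel : free_alg C X -> free_alg C X -> Prop).

Definition prj (u : free_alg C X) : presented rel := \pi_(presented rel) u.

Lemma prjB u v : prj (u - v) = prj u - prj v. Proof. exact: piB. Qed.
Lemma prjD u v : prj (u + v) = prj u + prj v. Proof. exact: piD. Qed.
Lemma prjM u v : prj (u * v) = prj u * prj v. Proof. exact: piM. Qed.
Lemma prj1 : prj 1 = 1. Proof. exact: pi1. Qed.
Lemma prjZ s u : prj (s *: u) = s *: prj u. Proof. exact: piZ. Qed.
Lemma prj0 : prj 0 = 0.
Proof. by have := prjB 0 0; rewrite subrr subrr. Qed.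
Lemma prj_sum (I : Type) (r : seq I) (P : pred I) F :
  prj (\sum_(i <- r | P i) F i) = \sum_(i <- r | P i) prj (F i).
Proof. exact: (big_morph prj prjD prj0). Qed.
Lemma prj_rel u v : rel u v -> prj u = prj v.
Proof. exact: pi_rel. Qed.

Lemma prj_rel_comm u v u' v' :
  rel (u * v) (u' * v') -> prj u * prj v = prj u' * prj v'.
Proof.
move=> e; exact: (etrans (esym (prjM u v)) (etrans (prj_rel e) (prjM u' v'))).
Qed.

Lemma prj_rel_scale u v s u' v' :
  rel (u * v) (s *: (u' * v')) -> prj u * prj v = s *: (prj u' * prj v').
Proof.
move=> e; apply: (etrans (esym (prjM u v)) (etrans (prj_rel e) _)).
exact: (etrans (prjZ s _) (congr1 _ (prjM u' v'))).
Qed.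

Lemma prj_rel_inv u v : rel (u * v) 1 -> prj u * prj v = 1.
Proof.
by move=> e; exact: (etrans (esym (prjM u v)) (etrans (prj_rel e) prj1)).
Qed.

Lemma prj_rel_bracket u v w :
  rel (u * v - v * u) w -> prj u * prj v - prj v * prj u = prj w.
Proof.
move=> e; apply: (etrans _ (prj_rel e)); apply: (etrans _ (esym (prjB _ _))).
exact: (esym (congr2 (fun a b => a - b) (prjM u v) (prjM v u))).
Qed.

Lemma prj_sqr u : prj (u ^+ 2) = prj u * prj u. Proof. exact: prjM. Qed.
End Projection.

(** The proof that $1\ne0$ is an argument of the type, so that the structure of a nonzero algebra
    can be attached to it. *)
Definition nontrivial_qeuclid (C : fieldType) (q qh : C) (N : nat)
  (nz : 1 != 0 :> qeuclid q qh N) : Type := qeuclid q qh N.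

(** * The realization inside a nonzero $\mathcal{A}_N$ *)

Section Nontrivial.
Variables (C : fieldType) (qh : C) (N : nat).
Local Notation q := (qh ^+ 2).
Hypothesis nz : 1 != 0 :> qeuclid q qh N.
Local Notation B := (nontrivial_qeuclid nz).

HB.instance Definition _ := GRing.PzRing.on B.
HB.instance Definition _ := GRing.Lmodule.on B.
HB.instance Definition _ := GRing.PzSemiRing_isNonZero.Build B nz.
HB.instance Definition _ := GRing.Lmodule_isLalgebra.Build C B
  (@presented_scaleAl C _ (@relA C q qh N)).
HB.instance Definition _ := GRing.Lalgebra_isAlgebra.Build C B
  (@presented_scaleAr C _ (@relA C q qh N)).

Variable gam : 'I_N -> C.
Hypotheses (N_gt1 : (1 < N)%N) (qh0 : qh != 0) (k0 : q - q^-1 != 0)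
  (w0 : forall j, radial_weight N qh j != 0).
Hypotheses
  (gam_0 : forall a : 'I_N, odd N -> idx a = 0 -> gam a = qh * (h_ qh)^-1)
  (gam_1 : forall a : 'I_N, idx a = 1 ->
     gam a * gam (rev_ord a) =
       if odd N then - q * (h_ qh) ^- 2 else (k_ q) ^- 2)
  (gam_gt1 : forall a : 'I_N, 1 < idx a ->
     gam a * gam (rev_ord a) =
       - q * (k_ q) ^- 2 * omega qh N (idx a) * omega qh N (idx a - 1)).

Local Notation p := (@prj C _ (@relA C q qh N)).

Lemma qeuclid_realization (L : 'I_N -> 'I_N -> B) :
  (forall i j, L i j = Lambda_comm (A := B) qh (fun i => p (fx C i))
    (fun j => p (frV C N j)) (p (fL C N)) (p (fLV C N)) (p (fK C N)) (p (fKV C N))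
    gam i j) ->
  [/\ forall i j, idx j < idx i -> L i j = 0,
      \prod_(i < N) L i i = 1,
      forall i h, \sum_j \sum_l metric qh l j *: (L i j * L h l)
        = metric qh h i *: 1
    & forall i h, \sum_j \sum_l metric qh l j *: (L j i * L l h)
        = metric qh h i *: 1] /\
  [/\ forall a b e f, \sum_s \sum_t Rhat q qh a b s t *: (L t f * L s e)
        = \sum_s \sum_t Rhat q qh t s e f *: (L b s * L a t),
      forall i a b, (p (fx C i) : B) * L a b
        = \sum_j \sum_m Rhat q qh j i m b *: (L a j * p (fx C m))
    & forall a b, (p (fL C N) : B) * L a b = L a b * p (fL C N)].
Proof.
move=> /(fun LE => boolp.funext (fun i => boolp.funext (LE i))) ->.
apply: (@euclid_realization C B N qh _ (fun j => p (fr C N j))) => //.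
- by move=> i j ij nij; exact: (prj_rel_scale (A_xx q qh ij nij)).
- move=> i i1; apply: (etrans (prj_rel_bracket (A_xcomm q qh i1))).
  exact: (etrans (prjZ _ _ _) (congr1 _ (prj_sqr _ _))).
- move=> i i1; apply: (etrans (prj_rel_bracket (A_x1comm q qh i1))).
  case: (odd N); last exact: prj0.
  exact: (etrans (prjZ _ _ _) (congr1 _ (prj_sqr _ _))).
- move=> j v; apply: (etrans (esym (prj_sqr _ _)) (etrans (prj_rel (A_r2 q qh v)) _)).
  apply: (etrans (prj_sum _ _ _ _)); apply: eq_bigr => i _.
  apply: (etrans (prj_sum _ _ _ _)); apply: eq_bigr => l _.
  exact: (etrans (prjZ _ _ _) (congr1 _ (prjM _ _ _))).
- by move=> i oN i0; exact: (prj_rel (A_r0 q qh oN i0)).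
- by move=> i j v ij; exact: (prj_rel_comm (A_xr q qh v ij)).
- by move=> i j v ij; exact: (prj_rel_scale (A_xr_lt q qh v ij)).
- by move=> i j v ij; exact: (prj_rel_scale (A_xr_gt q qh v ij)).
- by move=> i j vi vj; exact: (prj_rel_comm (A_rr q qh vi vj)).
- by move=> j v; exact: (prj_rel_inv (A_rrV q qh v)).
- by move=> j v; exact: (prj_rel_inv (A_rVr q qh v)).
- exact: (prj_rel_inv (A_LLV q qh N)).
- exact: (prj_rel_inv (A_LVL q qh N)).
- by move=> i; exact: (prj_rel_scale (A_xL q qh i)).
- by move=> j v; exact: (prj_rel_scale (A_rL q qh v)).
- by move=> eN; exact: (prj_rel_inv (A_KKV q qh eN)).
- by move=> eN; exact: (prj_rel_inv (A_KVK q qh eN)).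
- by move=> i eN i1; exact: (prj_rel_scale (A_Kx1 q qh eN i1)).
- by move=> i eN i1; exact: (prj_rel_scale (A_KxN1 q qh eN i1)).
- by move=> i eN i1; exact: (prj_rel_comm (A_Kx q qh eN i1)).
- by move=> j eN v; exact: (prj_rel_comm (A_Kr q qh eN v)).
- by move=> eN; exact: (prj_rel_comm (A_KL q qh eN)).
Qed.
End Nontrivial.

(** If $z+z^{-1}=0$ for $z=q^j\eta^{-1}$, then $z^4=1$, so $q^{4j}=\eta^4$, which is $q^2$ for [N]
    odd and $1$ for [N] even. This makes $q$ a root of unity, except for $j=0$ and [N] even, where
    the weight is 2. *)
Lemma radial_weight_neq0 (C : numFieldType) (qh : C) (N j : nat) :
  (forall m : nat, (0 < m)%N -> (qh ^+ 2) ^+ m != 1) -> qh != 0 ->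
  radial_weight N qh j != 0.
Proof.
move=> nroot qh0; apply/negP => /eqP; rewrite /radial_weight -[X in _ + X]invf_div.
have e0 := eta_neq0 N qh0; have q0 : (qh ^+ 2) ^+ j != 0 by rewrite !expf_neq0.
set z := _ / _ => zz; have z0 : z != 0 by rewrite mulf_neq0 ?invr_eq0.
have z2 : z ^+ 2 = -1.
  by move/eqP: zz; rewrite addr_eq0 => /eqP ze; rewrite expr2 {2}ze mulrN divff.
have z4 : (qh ^+ 2) ^+ (4 * j) = eta_ N qh ^+ 4.
  have : z ^+ 4 = 1 by rewrite (exprM z 2 2) z2 sqrrN expr1n.
  rewrite /z expr_div_n => ze.
  have := congr1 (fun y => y * eta_ N qh ^+ 4) ze.
  by rewrite divfK ?expf_neq0 // mul1r -[LHS]exprM mulnC.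
move: z4 z2; rewrite /z /eta_; case: (odd N) => z4 z2.
  case: j z4 {z2 zz z0 z q0} => [|j] z4.
    by have /eqP := nroot 2 isT; apply; rewrite -exprM -z4 muln0 expr0.
  have /eqP := nroot (4 * j).+2 isT; apply.
  apply: (mulfI (_ : (qh ^+ 2) ^+ 2 != 0)); first by rewrite !expf_neq0.
  by rewrite mulr1 -exprD -[RHS]exprM -z4; congr (_ ^+ _); lia.
case: j z4 z2 {zz z0 z q0} => [|j] z4 z2.
  move/eqP: z2; rewrite expr0 divr1 expr1n -subr_eq0 opprK.
  by rewrite -[1 + 1]/(2%:R) pnatr_eq0.
by have /eqP := nroot (4 * j.+1)%N isT; apply; rewrite z4 expr1n.
Qed.

(** * The homomorphism onto $\mathcal{A}_N$ *)

Theorem theorem2 (R : realType) (N : nat) (q qh : R[i]) (gam : 'I_N -> R[i])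
    (N_ge3 : (3 <= N)%N)
    (q_neq0 : q != 0)
    (q_not_root_of_unity : forall m : nat, (0 < m)%N -> q ^+ m != 1)
    (qh_sqrt : qh ^+ 2 = q)
    (gam_0 : forall a : 'I_N, odd N -> idx a = 0 -> gam a = qh * (h_ qh)^-1)
    (gam_1 : forall a : 'I_N, idx a = 1 ->
       gam a * gam (rev_ord a) =
         if odd N then - q * (h_ qh) ^- 2 else (k_ q) ^- 2)
    (gam_gt1 : forall a : 'I_N, 1 < idx a ->
       gam a * gam (rev_ord a) =
         - q * (k_ q) ^- 2 * omega qh N (idx a) * omega qh N (idx a - 1)) :
  exists phi : {rmorphism crossprod q qh N -> qeuclid q qh N},
    [/\ scalable phi,
        forall a : qeuclid q qh N, phi (embA a) = a
      & forall i j : 'I_N,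
          phi (Lplus q qh i j) =
            \sum_h \sum_k
              (metric qh i h * metric qh k j) *:
              (Lambda q qh N *
                (lambda_bar q qh gam h * x_ q qh k
                 - x_ q qh k * lambda_bar q qh gam h))].
Proof.
subst q; have qh0 : qh != 0 by move: q_neq0; rewrite expf_eq0.
have k0 : qh ^+ 2 - (qh ^+ 2)^-1 != 0.
  rewrite subr_eq0; apply: contra (q_not_root_of_unity 2%N isT) => /eqP e.
  by rewrite expr2 {2}e divff.
have w0 j : radial_weight N qh j != 0 by exact: radial_weight_neq0.
(* [L] is kept abstract and known only through [LE], so that conversion does not unfold the
   brackets. *)
have [L LE] : exists L : 'I_N -> 'I_N -> qeuclid (qh ^+ 2) qh N,
    forall i j, L i j = \sum_h \sum_k
      (metric qh i h * metric qh k j) *: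
      (Lambda (qh ^+ 2) qh N *
        (lambda_bar (qh ^+ 2) qh gam h * x_ (qh ^+ 2) qh k
         - x_ (qh ^+ 2) qh k * lambda_bar (qh ^+ 2) qh gam h)).
  by eexists.
(* Generators of $\mathcal{A}_N$ go to themselves, those of $U_q^+so(N)$ to representatives of their
   prescribed images. *)
pose f (g : genX N) : free_alg R[i] (genA N) :=
  match g with inl a => fgen R[i] a | inr ij => repr (L ij.1 ij.2) end.
pose psi := lift_pi (@relA R[i] (qh ^+ 2) qh N) f.
have psiA u : psi (inA u) = prj (@relA R[i] (qh ^+ 2) qh N) u.
  exact: (congr1 _ (@freelift_freemap _ _ _ (inl : genA N -> genX N) f (fun=> erefl) u)).
have psiL i j : psi (inU (fl R[i] i j)) = L i j.
  apply: (etrans (congr1 (lift_pi _ f) (freemap_gen _ _ _))).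
  apply: (etrans (congr1 _ (freelift_gen _ _))); exact: reprK.
have psiB u v : psi (u - v) = psi u - psi v by exact: lift_piB.
have psiM u v : psi (u * v) = psi u * psi v by exact: lift_piM.
have psi1 : psi 1 = 1 by exact: lift_pi1.
have psi0 : psi 0 = 0 by exact: lift_pi0.
have psiZ s u : psi (s *: u) = s *: psi u by exact: lift_piZ.
have psiD u v : psi (u + v) = psi u + psi v.
  apply: (etrans (congr1 psi (_ : u + v = u - (0 - v)))).
    by rewrite sub0r opprK.
  by rewrite !psiB psi0 sub0r opprK.
have inU1 : inU 1 = 1 :> free_alg R[i] (genX N) by exact: rmorph1.
have inU0 : inU 0 = 0 :> free_alg R[i] (genX N) by exact: raddf0.
have psiUM u v : psi (inU (u * v)) = psi (inU u) * psi (inU v).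
  exact: (etrans (congr1 psi (rmorphM (@inU R[i] N) u v)) (psiM _ _)).
have psiUZ s u : psi (inU (s *: u)) = s *: psi (inU u).
  exact: (etrans (congr1 psi (freemapZ _ s u)) (psiZ _ _)).
have psiUD u v : psi (inU (u + v)) = psi (inU u) + psi (inU v).
  exact: (etrans (congr1 psi (raddfD (@inU R[i] N) u v)) (psiD _ _)).
have psiU0 : psi (inU 0) = 0 by rewrite inU0 psi0.
have psiU1 : psi (inU 1) = 1 by rewrite inU1 psi1.
have psiLL (F : 'I_N -> 'I_N -> R[i]) (a b c d : 'I_N -> 'I_N -> 'I_N) :
    psi (inU (\sum_s \sum_t F s t *: (fl R[i] (a s t) (b s t) * fl R[i] (c s t) (d s t))))
    = \sum_s \sum_t F s t *: (L (a s t) (b s t) * L (c s t) (d s t)).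
  apply: (etrans (big_morph (fun u => psi (inU u)) psiUD psiU0 _ _ _)).
  apply: eq_bigr => s _.
  apply: (etrans (big_morph (fun u => psi (inU u)) psiUD psiU0 _ _ _)).
  apply: eq_bigr => t _.
  apply: (etrans (psiUZ (F s t) (fl _ (a s t) (b s t) * fl _ (c s t) (d s t)))).
  apply: congr1; apply: (etrans (psiUM (fl _ (a s t) (b s t)) (fl _ (c s t) (d s t)))).
  exact: (congr2 *%R (psiL (a s t) (b s t)) (psiL (c s t) (d s t))).
have rel0 u v : relX (qh ^+ 2) qh u v -> psi u = psi v.
  (* In the zero ring every relation holds; otherwise [qeuclid] is a nonzero algebra, to which the
     realization applies. *)
  have [z1|nz] := eqVneq (1 : qeuclid (qh ^+ 2) qh N) 0.
    have all0 (y : qeuclid (qh ^+ 2) qh N) : y = 0.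
      exact: (etrans (esym (mulr1 y))
        (etrans (congr1 (fun t => y * t) z1) (mulr0 y))).
    by move=> _; exact: (etrans (all0 (psi u)) (esym (all0 (psi v)))).
  have LE' i j : L i j = Lambda_comm (A := nontrivial_qeuclid nz) qh
      (fun i => prj (@relA _ (qh ^+ 2) qh N) (fx _ i))
      (fun j => prj (@relA _ (qh ^+ 2) qh N) (frV _ N j))
      (prj (@relA _ (qh ^+ 2) qh N) (fL _ N)) (prj (@relA _ (qh ^+ 2) qh N) (fLV _ N))
      (prj (@relA _ (qh ^+ 2) qh N) (fK _ N)) (prj (@relA _ (qh ^+ 2) qh N) (fKV _ N))
      gam i j.
    apply: (etrans (LE i j)); rewrite /Lambda_comm.
    apply: eq_bigr => h _; apply: eq_bigr => l _.
    apply: (congr1 (fun z => (metric qh i h * metric qh l j) *: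
      (Lambda (qh ^+ 2) qh N *
        (z * x_ (qh ^+ 2) qh l - x_ (qh ^+ 2) qh l * z)))).
    by rewrite /lambda_bar /lambda; do 3 (case: ifP => _; first exact: erefl).
  have [[tri det up lo] [rll xL LL]] := qeuclid_realization
    (ltnW N_ge3) qh0 k0 w0 gam_0 gam_1 gam_gt1 LE'.
  case=> [{}u {}v uv|{}u {}v uv|i a b|a b].
  - exact: (etrans (psiA u) (etrans (prj_rel uv) (esym (psiA v)))).
  - case: uv => [i j ij||i h|i h|a b e g].
    + exact: (etrans (psiL i j) (etrans (tri i j ij) (esym psiU0))).
    + apply: (etrans _ (esym psiU1)); apply: (etrans _ det).
      apply: (etrans (big_morph (fun u => psi (inU u)) psiUM psiU1 _ _ _)).
      apply: eq_bigr => i _; exact: (psiL i i).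
    + apply: (etrans (psiLL (fun j l => metric qh l j) (fun _ _ => i)
        (fun j _ => j) (fun _ _ => h) (fun _ l => l))).
      apply: (etrans (up i h)).
      exact: (esym (etrans (psiUZ _ 1) (congr1 ( *:%R _) psiU1))).
    + apply: (etrans (psiLL (fun j l => metric qh l j) (fun j _ => j)
        (fun _ _ => i) (fun _ l => l) (fun _ _ => h))).
      apply: (etrans (lo i h)).
      exact: (esym (etrans (psiUZ _ 1) (congr1 ( *:%R _) psiU1))).
    + apply: (etrans (psiLL (fun s t => Rhat _ qh a b s t) (fun _ t => t)
        (fun _ _ => g) (fun s _ => s) (fun _ _ => e))).
      apply: (etrans (rll a b e g)); apply: esym.
      exact: (psiLL (fun s t => Rhat _ qh t s e g) (fun _ _ => b)
        (fun s _ => s) (fun _ _ => a) (fun _ t => t)).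
  - apply: (etrans (psiM (inA (fx _ i)) (inU (fl _ a b)))).
    apply: (etrans (congr2 *%R (psiA (fx _ i)) (psiL a b))).
    apply: (etrans (xL i a b)); apply: esym.
    apply: (etrans (big_morph psi psiD psi0 _ _ _)).
    apply: eq_bigr => s _; apply: (etrans (big_morph psi psiD psi0 _ _ _)).
    apply: eq_bigr => t _.
    apply: (etrans (psiZ _ (inU (fl _ a s) * inA (fx _ t)))); apply: congr1.
    apply: (etrans (psiM (inU (fl _ a s)) (inA (fx _ t)))).
    exact: (congr2 *%R (psiL a s) (psiA (fx _ t))).
  - apply: (etrans (psiM (inA (fL _ N)) (inU (fl _ a b)))).
    apply: (etrans (congr2 *%R (psiA (fL _ N)) (psiL a b))).
    apply: (etrans (LL a b)); apply: esym.
    apply: (etrans (psiM (inU (fl _ a b)) (inA (fL _ N)))).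
    exact: (congr2 *%R (psiL a b) (psiA (fL _ N))).
exists (induced_rmorphism rel0); split.
- exact: (induced_scale rel0).
- move=> a; apply: (etrans (induced_pi rel0 (inA (repr a)))).
  exact: (etrans (psiA (repr a)) (reprK a)).
- move=> i j; apply: (etrans (induced_pi rel0 (inU (fl _ i j)))).
  exact: (etrans (psiL i j) (LE i j)).
Qed.
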